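(* Suppose $\mathbb{E}_{P_0}K_{P_0}(X,X)<\infty$, Stein's identity $\mathbb{E}_{P_0}\xi_{P_0}(X)=0$ holds, $\operatorname{tr}(C_\star)>0$, and $\mathbb{E}_{P_0}K_{P_0}(X,X)^2<\infty$. Let $X_1,\dots,X_n$ be i.i.d. from $P_0$. Then for \[ n\ge n_0:=\left\lceil\frac{\mathbb{E}_{P_0}K_{P_0}(X,X)^2}{\operatorname{tr}(C_\star)^2}\right\rceil \] we have \[ \frac12\sqrt{\frac{\operatorname{tr}(C_\star)}{n}}\le\mathbb{E}_{P_0}\widehat{\mathrm{KSD}}_V\le\sqrt{\frac{\operatorname{tr}(C_\star)}{n}}. \]
   Context: $P_0$ is a fixed probability distribution on $\mathcal{X}\subseteq\mathbb{R}^d$ with a continuously differentiable, everywhere positive density $p_0$; its score is $s_0(x)=\nabla\log p_0(x)$. $k\in C^{1,1}(\mathcal{X}\times\mathcal{X})$ is a positive definite kernel with reproducing kernel Hilbert space $\mathcal{H}_k$, and $\mathcal{H}:=\mathcal{H}_k^d$. The Langevin--Stein feature map is $\xi_{P_0}(x):=s_0(x)k(x,\cdot)+\nabla_x k(x,\cdot)\in\mathcal{H}$, and the Stein kernel is $K_{P_0}(x,y):=\langle\xi_{P_0}(x),\xi_{P_0}(y)\rangle_{\mathcal{H}}$. The plug-in (V-statistic) estimator is \[ \widehat{\mathrm{KSD}}_V:=\Bigl\|\frac1n\sum_{i=1}^n\xi_{P_0}(X_i)\Bigr\|_{\mathcal{H}}=\Bigl(\frac1{n^2}\sum_{i,j=1}^nK_{P_0}(X_i,X_j)\Bigr)^{1/2}.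 \] The Stein covariance operator is $C_\star:=\mathbb{E}_{P_0}[\xi_{P_0}(X)\otimes\xi_{P_0}(X)]$ on $\mathcal{H}$, where $a\otimes b$ is the operator $x\mapsto\langle b,x\rangle a$; it is positive, self-adjoint and trace class with $\operatorname{tr}(C_\star)=\mathbb{E}_{P_0}K_{P_0}(X,X)$. $\lceil u\rceil$ is the smallest integer $\ge u$. *)

(* Defs.v *)
From HB Require Import structures.
From mathcomp Require Import all_boot all_order all_algebra.
From mathcomp Require Import all_classical all_reals all_analysis.

Set Implicit Arguments.
Unset Strict Implicit.
Unset Printing Implicit Defensive.

Import Order.TTheory GRing.Theory Num.Theory.
Import numFieldNormedType.Exports.

Local Open Scope classical_set_scope.
Local Open Scope ring_scope.

(* A real Hilbert space: the norm is the one induced by the inner product, and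
   completeness is stated for Cauchy sequences with respect to that norm. *)
Record hilbertType (R : realType) := Hilbert {
  hilbert_space :> lmodType R;
  hdot : {dot hilbert_space for idfun};
  hilbert_complete : forall u : nat -> hilbert_space,
    (forall e : R, 0 < e -> exists N, forall m n, (N <= m)%N -> (N <= n)%N ->
       Num.sqrt (hdot (u m - u n) (u m - u n)) < e) ->
    exists l, Num.sqrt (hdot (u n - l) (u n - l)) @[n --> \oo] --> (0 : R) }.

Definition hnorm (R : realType) (E : hilbertType R) (x : E) : R :=
  Num.sqrt (hdot E x x).

Section hilbert_power.
Context {R : realType} (d : nat) (E : hilbertType R).

Definition pow_dot (f g : {ffun 'I_d -> E}) : R := \sum_(i < d) hdot E (f i) (g i).

Lemma pow_dot_bilinear :
  bilinear_for ( *%R : R -> R -> R) (idfun \; *%R) pow_dot.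
Proof.
split=> f a g h; rewrite /pow_dot /= mulr_sumr -big_split /=;
  apply: eq_bigr => i _; rewrite !ffunE.
  by rewrite linearPl.
by rewrite linearPr.
Qed.

HB.instance Definition _ := @bilinear_isBilinear.Build R
  {ffun 'I_d -> E} {ffun 'I_d -> E} R *%R (idfun \; *%R) pow_dot pow_dot_bilinear.

Lemma pow_dot_sym f g : pow_dot f g = (-1) ^+ false * idfun (pow_dot g f).
Proof.
rewrite expr0 mul1r /= /pow_dot; apply: eq_bigr => i _.
by rewrite (hermitian_subproof (f i)) expr0 mul1r.
Qed.

HB.instance Definition _ :=
  @isHermitianSesquilinear.Build R {ffun 'I_d -> E} false idfun pow_dot pow_dot_sym.

Lemma pow_dot_gt0 f : f != 0 -> 0 < pow_dot f f.
Proof.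
move=> f0; have [i fi0] : exists i, f i != 0.
  apply: contrapT => /forallNP h; move/eqP: f0; apply.
  by apply/ffunP => i; rewrite ffunE; apply/eqP/negPn/negP/(h i).
rewrite /pow_dot (bigD1 i)//= ltr_pwDl ?neq0_dnorm_gt0//.
apply: sumr_ge0 => j _.
have [->|?] := eqVneq (f j) 0; first by rewrite linear0l.
exact/ltW/neq0_dnorm_gt0.
Qed.

HB.instance Definition _ :=
  @isDotProduct.Build R {ffun 'I_d -> E} pow_dot pow_dot_gt0.

Lemma pow_complete (u : nat -> {ffun 'I_d -> E}) :
  (forall e : R, 0 < e -> exists N, forall m n, (N <= m)%N -> (N <= n)%N ->
     Num.sqrt (pow_dot (u m - u n) (u m - u n)) < e) ->
  exists l, Num.sqrt (pow_dot (u n - l) (u n - l)) @[n --> \oo] --> (0 : R).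
Proof.
have dot_ge0 (x : E) : 0 <= hdot E x x.
  have [->|?] := eqVneq x 0; first by rewrite linear0l.
  exact/ltW/neq0_dnorm_gt0.
move=> u_cauchy.
have /choice[l lP] : forall i, exists l : E,
    Num.sqrt (hdot E (u n i - l) (u n i - l)) @[n --> \oo] --> (0 : R).
  move=> i; apply: hilbert_complete => e /u_cauchy[N NP].
  exists N => m n Nm Nn; apply: le_lt_trans (NP _ _ Nm Nn).
  rewrite ler_wsqrtr// /pow_dot (bigD1 i)//= !ffunE lerDl.
  exact: sumr_ge0.
exists [ffun i => l i].
have -> : (0 : R) = Num.sqrt (\sum_(i < d) 0) by rewrite big1// sqrtr0.
apply: (@continuous_cvg _ _ _ _ _ (fun n => pow_dot (u n - _) (u n - _))
  Num.sqrt); first exact: sqrt_continuous.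
rewrite /pow_dot; apply: cvg_big => [|i _]; first exact: add_continuous.
under eq_fun do rewrite !ffunE -(sqr_sqrtr (dot_ge0 _)) expr2.
have := cvgM (lP i) (lP i); rewrite mulr0; exact.
Qed.

Definition hilbert_pow : hilbertType R :=
  @Hilbert R {ffun 'I_d -> E} pow_dot pow_complete.

End hilbert_power.

(* Orthonormal bases are maximal orthonormal families (no countability is
   imposed). *)
Definition orthonormal_basis (R : realType) (E : hilbertType R) (B : set E) :=
  (forall e f, B e -> B f -> hdot E e f = (e == f)%:R) /\
  (forall x, (forall e, B e -> hdot E x e = 0) -> x = 0).

(* Trace of a positive operator, computed in some orthonormal basis. *)
Definition trace (R : realType) (E : hilbertType R) (C : E -> E) : \bar R :=
  \esum_(e in xget set0 (@orthonormal_basis R E)) (hdot E (C e) e)%:E.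

Definition tensor (R : realType) (E : hilbertType R) (a b : E) : E -> E :=
  fun x => hdot E b x *: a.

Section bochner.
Context {disp : measure_display} {T : measurableType disp} {R : realType}.
Context (E : hilbertType R) (P : probability T R) (D : set T).

Record simple_map := SimpleMap {
  simple_size : nat;
  simple_set : 'I_simple_size -> set T;
  simple_val : 'I_simple_size -> E;
  simple_measurable : forall i, measurable (simple_set i) }.

Definition simple_apply (s : simple_map) (x : T) : E :=
  \sum_(i < simple_size s) \1_(simple_set i) x *: simple_val i.

Definition simple_integral (s : simple_map) : E :=
  \sum_(i < simple_size s) fine (P (D `&` simple_set i)) *: simple_val i.

(* [Z] is Bochner integrable on [D], with integral [h]. *)
Definition is_bochner_integral (Z : T -> E) (h : E) :=
  exists s : nat -> simple_map,
  [/\ forall n, measurable_fun D (fun x => hnorm (Z x - simple_apply (s n) x)),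
      (\int[P]_(x in D) (hnorm (Z x - simple_apply (s n) x))%:E)%E
        @[n --> \oo] --> 0%E
    & hnorm (simple_integral (s n) - h) @[n --> \oo] --> (0 : R)].

(* Junk value 0 when [Z] is not Bochner integrable. *)
Definition bochner_integral (Z : T -> E) : E := xget 0 (is_bochner_integral Z).

End bochner.

(* R^d with its Borel sigma-algebra. *)
Definition borel (R : realType) (d : nat) := g_sigma_algebraType (@open 'rV[R]_d).

Definition is_lebesgue (R : realType) (d : nat)
    (lam : {measure set (borel R d) -> \bar R}) :=
  forall a b : 'rV[R]_d, (forall i, a 0 i <= b 0 i) ->
    lam [set x : 'rV[R]_d | forall i, a 0 i <= x 0 i <= b 0 i] =
    (\prod_(i < d) (b 0 i - a 0 i))%:E.

Definition has_density (R : realType) (d : nat) (X : set 'rV[R]_d)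
    (P : probability (borel R d) R) (p : 'rV[R]_d -> R) :=
  exists2 lam : {measure set (borel R d) -> \bar R}, is_lebesgue lam &
  forall A : set (borel R d), measurable A ->
    P A = (\int[lam]_(x in A `&` X) (p x)%:E)%E.

Section calculus.
Context {R : realType} {d : nat}.
Local Notation V := 'rV[R]_d.
Local Notation e_ i := (delta_mx 0 i : V).

Definition grad (f : V -> R) (x : V) : V := \row_(i < d) 'D_(e_ i) f x.

Definition C1 (X : set V) (f : V -> R) :=
  (forall x, X x -> differentiable f x) /\ {within X, continuous (grad f)}.

(* [partial1 k i x y] is the derivative of [k] in the i-th coordinate of its
   first argument, [partial2 k j x y] in the j-th coordinate of the second. *)
Definition partial1 (k : V -> V -> R) (i : 'I_d) (x y : V) : R :=
  'D_(e_ i) (fun z => k z y) x.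

Definition partial2 (k : V -> V -> R) (j : 'I_d) (x y : V) : R :=
  'D_(e_ j) (fun z => k x z) y.

Definition jointly_continuous (X : set V) (g : V -> V -> R) :=
  {within X `*` X, continuous (fun z : V * V => g z.1 z.2)}.

(* C^{1,1}(X x X): continuous partial derivatives of order at most one in each
   of the two arguments. *)
Definition C11 (X : set V) (k : V -> V -> R) :=
  [/\ jointly_continuous X k,
      forall i, (forall x y, X x -> X y -> derivable (fun z => k z y) x (e_ i)) /\
        jointly_continuous X (partial1 k i),
      forall j, (forall x y, X x -> X y -> derivable (fun z => k x z) y (e_ j)) /\
        jointly_continuous X (partial2 k j)
    & forall i j,
        (forall x y, X x -> X y -> derivable (partial1 k i x) y (e_ j)) /\
        jointly_continuous X (partial2 (partial1 k i) j)].

Definition positive_definite (X : set V) (k : V -> V -> R) :=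
  (forall x y, X x -> X y -> k x y = k y x) /\
  (forall m (x : 'I_m -> V) (c : 'I_m -> R), (forall i, X (x i)) ->
     0 <= \sum_(i < m) \sum_(j < m) c i * c j * k (x i) (x j)).

(* The reproducing kernel Hilbert space of [k]: a Hilbert space of functions on
   [X] (an element [f] is the function [rkhs_eval f] restricted to [X]) that
   contains the sections of [k] and has the reproducing property. *)
Record rkhs (X : set V) (k : V -> V -> R) := RKHS {
  rkhs_space :> hilbertType R;
  rkhs_eval : rkhs_space -> V -> R;
  rkhs_eval_linear : forall a f g x, X x ->
    rkhs_eval (a *: f + g) x = a * rkhs_eval f x + rkhs_eval g x;
  rkhs_eval_inj : forall f g,
    (forall x, X x -> rkhs_eval f x = rkhs_eval g x) -> f = g;
  rkhs_reproducing : forall x, X x -> exists2 kx : rkhs_space,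
    forall y, X y -> rkhs_eval kx y = k x y &
    forall f, hdot rkhs_space f kx = rkhs_eval f x }.

Context {X : set V} {k : V -> V -> R} (H : rkhs X k).

(* The function [g] on [X] as an element of the RKHS; junk value 0 when [g] does
   not belong to it. *)
Definition rkhs_elt (g : V -> R) : H :=
  xget 0 [set h : H | forall y, X y -> rkhs_eval h y = g y].

Context (p0 : V -> R).

Definition score (x : V) : V := grad (fun y => ln (p0 y)) x.

Definition stein_feature (x : borel R d) : hilbert_pow d H :=
  [ffun i => score x 0 i *: rkhs_elt (k x) + rkhs_elt (partial1 k i x)].

Definition stein_kernel (x y : V) : R :=
  hdot (hilbert_pow d H) (stein_feature x) (stein_feature y).

Definition stein_covariance (P0 : probability (borel R d) R) :
    hilbert_pow d H -> hilbert_pow d H :=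
  fun f => bochner_integral P0 X
    (fun x => tensor (stein_feature x) (stein_feature x) f).

Definition ksd_V (n : nat) (x : 'I_n -> V) : R :=
  hnorm (n%:R^-1 *: \sum_(i < n) stein_feature (x i)).

End calculus.

Arguments stein_covariance {R d X k} H p0 P0 _.

Definition iid (R : realType) (disp disp' : measure_display)
    (Omega : measurableType disp) (T : measurableType disp')
    (P : probability Omega R) (n : nat) (X : 'I_n -> Omega -> T)
    (mu : probability T R) :=
  [/\ forall i, measurable_fun setT (X i),
      forall i (A : set T), measurable A -> P (X i @^-1` A) = mu A
    & forall (J : {set 'I_n}) (A : 'I_n -> set T), (forall i, measurable (A i)) ->
        P (\bigcap_(i in [set` J]) (X i @^-1` A i)) =
        (\prod_(i in J) P (X i @^-1` A i))%E].

(* Main.v *)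
Require Import Defs.
From HB Require Import structures.
From mathcomp Require Import all_boot all_order all_algebra.
From mathcomp Require Import finmap.
From mathcomp Require Import all_classical all_reals all_analysis measurable_realfun.
From mathcomp Require Import ring lra.

(* Let S be the sum of the n features xi(X_i). Independence and E xi = 0 give
   E |S|^2 = n tr C, and expanding |S + xi(X_j)|^4 gives by induction
   E |S|^4 <= n E K^2 + 3 n (n - 1) (tr C)^2 <= 4 (n tr C)^2 for n >= n_0. The
   upper bound is then Jensen's inequality and the lower bound is Hoelder's,
   E |S| >= (E |S|^2)^(3/2) / (E |S|^4)^(1/2).
   For the identity tr C = E K(X, X) and for measurability: since k is C^{1,1},
   mixed difference quotients of k show that d_i k(x, .) is a limit in the RKHS
   with <d_i k(x, .), d_i k(y, .)> = d_i d'_i k(x, y), so xi is norm continuous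
   on X, hence a pointwise limit of finitely valued maps. Such a map is nearly
   contained in the span of finitely many basis vectors, whence Parseval's
   identity can be integrated even if the basis is uncountable. *)

Set Implicit Arguments.
Unset Strict Implicit.
Unset Printing Implicit Defensive.

Import Order.TTheory GRing.Theory Num.Theory.
Import numFieldNormedType.Exports.

Local Open Scope classical_set_scope.
Local Open Scope ring_scope.

(** * Hilbert spaces *)

(** Separability is not part of [hilbertType], and this shapes the measure theory: sums of Borel
    maps may fail to be Borel, and an uncountable Parseval sum cannot be exchanged with an integral
    by monotone convergence. Pointwise limits of finitely valued measurable maps are stable under
    sums and inner products and admit dominated approximations, so they serve as the notion of
    measurability. Bochner integrals enter through their pairings with fixed vectors, which are
    scalar integrals. In the fourth moment the odd terms are the obstacle. With S the partial sum
    and Z the new feature, |S|^2 <S, Z> has mean 0 because Z is centred, but |Z|^2 <S, Z> need not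
    vanish when Z is integrated out: it becomes <S, V> with V the mean of |Z|^2 Z, and disappears
    because S is centred. The constant 3 n (n - 1) is the sum of 6 m over m < n, and the factor 1/2
    of the lower bound is 1 / sqrt 4, from the bound 4 (n tr C)^2. *)

Section hilbert_theory.
Context {R : realType} {E : hilbertType R}.
Implicit Types u v w : E.

Lemma dotC u v : hdot E u v = hdot E v u.
Proof. by rewrite (hermitian_subproof u) expr0 mul1r. Qed.

Lemma dot0l v : hdot E 0 v = 0. Proof. exact: linear0l. Qed.
Lemma dot0r v : hdot E v 0 = 0. Proof. exact: linear0r. Qed.
Lemma dotDl u v w : hdot E (u + v) w = hdot E u w + hdot E v w.
Proof. exact: linearDl. Qed.
Lemma dotDr u v w : hdot E u (v + w) = hdot E u v + hdot E u w.
Proof. exact: linearDr. Qed.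
Lemma dotBl u v w : hdot E (u - v) w = hdot E u w - hdot E v w.
Proof. exact: linearBl. Qed.
Lemma dotBr u v w : hdot E u (v - w) = hdot E u v - hdot E u w.
Proof. exact: linearBr. Qed.
Lemma dotZl a u v : hdot E (a *: u) v = a * hdot E u v.
Proof. exact: linearZl_LR. Qed.
Lemma dotZr a u v : hdot E u (a *: v) = a * hdot E u v.
Proof. by rewrite dotC dotZl dotC. Qed.

Lemma dot_suml I (r : seq I) (Q : pred I) (F : I -> E) v :
  hdot E (\sum_(i <- r | Q i) F i) v = \sum_(i <- r | Q i) hdot E (F i) v.
Proof. exact: linear_sumlz. Qed.
Lemma dot_sumr I (r : seq I) (Q : pred I) (F : I -> E) v :
  hdot E v (\sum_(i <- r | Q i) F i) = \sum_(i <- r | Q i) hdot E v (F i).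
Proof. exact: linear_sumr. Qed.

Lemma dot_ge0 u : 0 <= hdot E u u.
Proof.
have [->|?] := eqVneq u 0; first by rewrite dot0l.
exact/ltW/neq0_dnorm_gt0.
Qed.

Lemma dot_eq0 u : hdot E u u = 0 -> u = 0.
Proof.
move=> u0; apply/eqP; apply: contraT => u_neq0.
have : 0 < hdot E u u by exact: neq0_dnorm_gt0.
by rewrite u0 ltxx.
Qed.

Lemma hnorm_ge0 u : 0 <= hnorm u. Proof. exact: sqrtr_ge0. Qed.
Lemma sqr_hnorm u : hnorm u ^+ 2 = hdot E u u.
Proof. by rewrite sqr_sqrtr// dot_ge0. Qed.
Lemma hnorm0 : hnorm (0 : E) = 0. Proof. by rewrite /hnorm dot0l sqrtr0. Qed.
Lemma hnorm_eq0 u : hnorm u = 0 -> u = 0.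
Proof. by move=> u0; apply: dot_eq0; rewrite -sqr_hnorm u0 expr0n. Qed.

Lemma hnorm_opp u : hnorm (- u) = hnorm u.
Proof. by rewrite /hnorm -scaleN1r dotZl dotZr !mulN1r opprK. Qed.
Lemma hnormBC u v : hnorm (u - v) = hnorm (v - u).
Proof. by rewrite -hnorm_opp opprB. Qed.
Lemma hnormZ a u : hnorm (a *: u) = `|a| * hnorm u.
Proof.
by rewrite /hnorm dotZl dotZr mulrA -expr2 sqrtrM ?sqr_ge0// sqrtr_sqr.
Qed.

Lemma cauchy_schwarz_dot u v : `|hdot E u v| <= hnorm u * hnorm v.
Proof.
rewrite -sqrtrM ?dot_ge0// -sqrtr_sqr ler_wsqrtr//.
have [->|v0] := eqVneq v 0; first by rewrite !dot0r expr0n mulr0.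
have v_gt0 : 0 < hdot E v v by exact: neq0_dnorm_gt0.
(* This vector is [hdot E v v] times the component of [u] orthogonal to [v]; its squared norm is
   [hdot E v v] times the difference of the two sides. *)
have := dot_ge0 (hdot E v v *: u - hdot E u v *: v).
rewrite dotBl !dotBr !dotZl !dotZr (dotC v u) => h.
rewrite -subr_ge0 -(pmulr_rge0 _ v_gt0); apply: le_trans h _.
by rewrite le_eqVlt; apply/orP; left; apply/eqP; ring.
Qed.

Lemma ler_hnormD u v : hnorm (u + v) <= hnorm u + hnorm v.
Proof.
rewrite -(@ler_pXn2r _ 2)// ?nnegrE ?addr_ge0 ?hnorm_ge0//.
rewrite sqrrD !sqr_hnorm dotDl !dotDr (dotC v u).
have := ler_norm (hdot E u v); have := cauchy_schwarz_dot u v; lra.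
Qed.

Lemma ler_hnormB u v w : hnorm (u - w) <= hnorm (u - v) + hnorm (v - w).
Proof. by have := ler_hnormD (u - v) (v - w); rewrite addrA subrK. Qed.

Lemma ler_dist_hnorm u v : `|hnorm u - hnorm v| <= hnorm (u - v).
Proof.
have h (a b : E) : hnorm a - hnorm b <= hnorm (a - b).
  by rewrite lerBlDr; have := ler_hnormD (a - b) b; rewrite subrK.
by rewrite ler_norml h andbT -(opprB (hnorm v)) lerN2 hnormBC h.
Qed.

(** The carrier of a [hilbertType] is a bare module without topology, so convergence is expressed
    through real numbers. *)
Definition hcvg (u : nat -> E) (l : E) := hnorm (u n - l) @[n --> \oo] --> (0 : R).

Lemma hcvgP (u : nat -> E) (l : E) : hcvg u l <->
  forall e, 0 < e -> exists N, forall n, (N <= n)%N -> hnorm (u n - l) < e.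
Proof.
split=> [/cvgrPdist_lt h e e0|h].
  have [N _ hN] := h e e0; exists N => n Nn.
  by have := hN n Nn; rewrite sub0r normrN ger0_norm ?hnorm_ge0.
apply/cvgrPdist_lt => e e0; have [N hN] := h e e0; exists N => // n Nn /=.
by rewrite sub0r normrN ger0_norm ?hnorm_ge0 ?hN.
Qed.

Lemma hcvg_cst (l : E) : hcvg (fun=> l) l.
Proof. by apply/hcvgP => e e0; exists 0%N => n _; rewrite subrr hnorm0. Qed.

(** The filter is arbitrary because both sequences and limits at a point of R^d occur. *)
Lemma cvg_hnormD (T : Type) (F : set_system T) (u v : T -> E) (l m : E) : Filter F ->
  hnorm (u x - l) @[x --> F] --> (0 : R) -> hnorm (v x - m) @[x --> F] --> (0 : R) ->
  hnorm (u x + v x - (l + m)) @[x --> F] --> (0 : R).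
Proof.
move=> FF ul vm.
have h : hnorm (u x - l) + hnorm (v x - m) @[x --> F] --> (0 : R).
  by rewrite -[X in _ --> X]addr0; exact: cvgD.
apply: squeeze_cvgr (cvg_cst 0) h; apply: nearW => x; rewrite hnorm_ge0/=.
by rewrite opprD addrACA ler_hnormD.
Qed.

Lemma hcvgD (u v : nat -> E) (l m : E) :
  hcvg u l -> hcvg v m -> hcvg (fun n => u n + v n) (l + m).
Proof. exact: cvg_hnormD. Qed.

Lemma hcvgB (u v : nat -> E) (l m : E) :
  hcvg u l -> hcvg v m -> hcvg (fun n => u n - v n) (l - m).
Proof.
move=> ul vm; apply: hcvgD ul _.
rewrite /hcvg (_ : (fun _ => _) = fun n => hnorm (v n - m))//.
by apply/funext => n; rewrite -opprD hnorm_opp.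
Qed.

Lemma hcvg_hnorm (u : nat -> E) (l : E) : hcvg u l ->
  hnorm (u n) @[n --> \oo] --> hnorm l.
Proof.
move=> /hcvgP ul; apply/cvgrPdist_lt => e e0.
have [N hN] := ul e e0; exists N => // n Nn /=.
by rewrite distrC; apply: le_lt_trans (ler_dist_hnorm _ _) (hN n Nn).
Qed.

Lemma cvg_hnormZ (T : Type) (F : set_system T) (a : T -> R) (u : T -> E) (b : R) (l : E) :
  Filter F -> a x @[x --> F] --> b -> hnorm (u x - l) @[x --> F] --> (0 : R) ->
  hnorm (a x *: u x - b *: l) @[x --> F] --> (0 : R).
Proof.
move=> FF ab ul.
have h1 : `|a x| * hnorm (u x - l) @[x --> F] --> `|b| * 0.
  by apply: cvgM ul; exact: cvg_norm.
have h2 : `|a x - b| * hnorm l @[x --> F] --> `|b - b| * hnorm l.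
  by apply: cvgMl; apply: cvg_norm; apply: cvgB ab _; exact: cvg_cst.
have h3 : `|a x| * hnorm (u x - l) + `|a x - b| * hnorm l @[x --> F] --> (0 : R).
  rewrite [X in _ --> X](_ : 0 = `|b| * 0 + `|b - b| * hnorm l); first exact: cvgD h1 h2.
  by rewrite mulr0 subrr normr0 mul0r addr0.
apply: squeeze_cvgr (cvg_cst 0) h3; apply: nearW => x; rewrite hnorm_ge0/= -!hnormZ.
have := ler_hnormD (a x *: (u x - l)) ((a x - b) *: l).
by rewrite scalerBr scalerBl addrA subrK.
Qed.

Lemma hcvgZ (a : nat -> R) (u : nat -> E) (b : R) (l : E) :
  a n @[n --> \oo] --> b -> hcvg u l -> hcvg (fun n => a n *: u n) (b *: l).
Proof. by move=> ab ul; exact: cvg_hnormZ. Qed.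

Lemma hcvg_dot (u v : nat -> E) (l m : E) : hcvg u l -> hcvg v m ->
  hdot E (u n) (v n) @[n --> \oo] --> hdot E l m.
Proof.
move=> ul vm; apply/cvgrPdist_lt => e e0.
have : hnorm (u n) * hnorm (v n - m) + hnorm (u n - l) * hnorm m @[n --> \oo] --> (0 : R).
  have h1 : hnorm (u n) * hnorm (v n - m) @[n --> \oo] --> hnorm l * 0.
    by apply: cvgM vm; exact: hcvg_hnorm.
  have h2 : hnorm (u n - l) * hnorm m @[n --> \oo] --> 0 * hnorm m.
    exact: cvgMl ul.
  rewrite [X in _ --> X](_ : 0 = hnorm l * 0 + 0 * hnorm m); first exact: cvgD h1 h2.
  by rewrite mulr0 mul0r addr0.
move=> /cvgrPdist_lt/(_ e e0)[N _ hN]; exists N => // n Nn /=.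
have := hN n Nn; rewrite /= sub0r normrN; apply: le_lt_trans.
rewrite distrC [leRHS]ger0_norm; last by rewrite addr_ge0// mulr_ge0 ?hnorm_ge0.
rewrite [leLHS](_ : _ = `|hdot E (u n) (v n - m) + hdot E (u n - l) m|); last first.
  by rewrite dotBr dotBl addrA subrK.
by apply: le_trans (ler_normD _ _) (lerD _ _); exact: cauchy_schwarz_dot.
Qed.

Lemma hcvg_cauchy (u : nat -> E) :
  (forall e : R, 0 < e -> exists N, forall m n, (N <= m)%N -> (N <= n)%N ->
     hnorm (u m - u n) < e) -> exists l, hcvg u l.
Proof. by move=> /hilbert_complete. Qed.

End hilbert_theory.

(** * Finite orthonormal projections and density of the span of a basis *)

Section orthonormal_projection.
Context {R : realType} {E : hilbertType R} (B : set E).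
Hypothesis B_basis : orthonormal_basis B.
Implicit Types (u v : E) (F G : {fset E}).

Definition fproj F v : E := \sum_(e <- F) hdot E v e *: e.

Lemma fprojD F u v : fproj F (u + v) = fproj F u + fproj F v.
Proof. by rewrite -big_split/=; apply: eq_bigr => e _; rewrite dotDl scalerDl. Qed.

Lemma fprojB F u v : fproj F (u - v) = fproj F u - fproj F v.
Proof. by rewrite -sumrB; apply: eq_bigr => e _; rewrite dotBl scalerBl. Qed.

Lemma fprojZ F a u : fproj F (a *: u) = a *: fproj F u.
Proof.
by rewrite [in RHS]/fproj scaler_sumr; apply: eq_bigr => e _; rewrite dotZl scalerA.
Qed.

Lemma dot_fproj F v e : {subset F <= B} -> e \in F ->
  hdot E (fproj F v) e = hdot E v e.
Proof.
move=> FB eF; have Be : B e by rewrite -inE FB.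
rewrite dot_suml (big_fsetD1 e)//= dotZl B_basis.1// eqxx mulr1.
rewrite big_seq big1 ?addr0// => f; rewrite !inE => /andP[fe fF].
rewrite dotZl B_basis.1 ?(negbTE fe) ?mulr0//.
by rewrite -inE FB.
Qed.

Lemma fproj_basis F e : {subset F <= B} -> e \in F -> fproj F e = e.
Proof.
move=> FB eF; have Be : B e by rewrite -inE FB.
rewrite /fproj (big_fsetD1 e)//= B_basis.1// eqxx scale1r.
rewrite big_seq big1 ?addr0// => f; rewrite !inE => /andP[fe fF].
rewrite B_basis.1// 1?eq_sym ?(negbTE fe) ?scale0r//.
by rewrite -inE FB.
Qed.

(** [v] and its projection have the same inner product with the projection, namely the sum of the
    squared coefficients. *)
Lemma fproj_pythagoras F v : {subset F <= B} ->
  hdot E (v - fproj F v) (v - fproj F v) =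
  hdot E v v - \sum_(e <- F) hdot E v e ^+ 2.
Proof.
move=> FB; set S := \sum_(_ <- _) _.
have vP : hdot E v (fproj F v) = S.
  by rewrite dot_sumr; apply: eq_bigr => e _; rewrite dotZr expr2.
have PP : hdot E (fproj F v) (fproj F v) = S.
  rewrite {2}/fproj dot_sumr; rewrite /S big_seq [RHS]big_seq.
  by apply: eq_bigr => e eF; rewrite dotZr dot_fproj// expr2.
rewrite dotBl !dotBr vP PP (dotC _ v) vP; ring.
Qed.

Lemma fproj_residual_le F v : {subset F <= B} -> hnorm (v - fproj F v) <= hnorm v.
Proof.
move=> FB; rewrite /hnorm ler_wsqrtr// fproj_pythagoras// gerBl.
by apply: sumr_ge0 => e _; exact: sqr_ge0.
Qed.

(** Built term by term, repetitions allowed, so that closure under sums and scaling is a plain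
    induction; a finite set of basis vectors is recovered in [span_fproj]. *)
Inductive span : E -> Prop :=
| span0 : span 0
| spanD u a e : span u -> B e -> span (u + a *: e).

Lemma span_add u v : span u -> span v -> span (u + v).
Proof.
move=> su; elim => [|w a e _ IH Be]; first by rewrite addr0.
by rewrite addrA; exact: spanD.
Qed.

Lemma span_scale a u : span u -> span (a *: u).
Proof.
elim => [|w b e _ IH Be]; first by rewrite scaler0; exact: span0.
by rewrite scalerDr scalerA; exact: spanD.
Qed.

(** The claim covers every finite [G] above [F], so that the sets found for several vectors can be
    merged. *)
Lemma span_fproj u : span u -> exists2 F : {fset E}, {subset F <= B} &
  forall G, {subset G <= B} -> {subset F <= G} -> fproj G u = u.
Proof.
elim => [|w a e _ [F FB hF] Be].
  exists fset0 => // G _ _; rewrite /fproj big1// => e _.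
  by rewrite dot0l scale0r.
exists (e |` F)%fset.
  by move=> f; rewrite in_fset1U => /orP[/eqP->|/FB//]; rewrite inE.
move=> G GB FG; rewrite fprojD fprojZ hF// => [|f fF]; last first.
  by apply: FG; rewrite in_fset1U fF orbT.
by rewrite fproj_basis//; apply: FG; rewrite in_fset1U eqxx.
Qed.

(* The closest point w to v in the closed span of B is the limit of a minimizing
   sequence, Cauchy by the parallelogram law; v - w is orthogonal to B. *)
Lemma span_dense v e : 0 < e -> exists2 u, span u & hnorm (v - u) < e.
Proof.
move=> e0; pose D := [set hdot E (v - u) (v - u) | u in span].
have D0 : D !=set0 by exists (hdot E (v - 0) (v - 0)); exists 0 => //; exact: span0.
have Dlb : has_inf D by split=> //; exists 0 => _ [u _ <-]; exact: dot_ge0.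
pose m := inf D.
have m_le u : span u -> m <= hdot E (v - u) (v - u).
  by move=> su; apply: ge_inf; [exact: Dlb.2|exists u].
have /choice[s sP] : forall n, exists u,
    span u /\ hdot E (v - u) (v - u) < m + n.+1%:R^-1.
  move=> n; have n0 : (0 : R) < n.+1%:R^-1 by rewrite invr_gt0.
  have [_ [u su <-] h] := inf_adherent n0 Dlb.
  by exists u.
have s_cauchy : exists w, hcvg s w.
  apply: hcvg_cauchy => d d0.
  have [N N0] : exists N, 4 * N.+1%:R^-1 < d ^+ 2 :> R.
    exists (Num.truncn (4 / d ^+ 2)).
    rewrite ltr_pdivrMr// mulrC -ltr_pdivrMr ?exprn_gt0//.
    exact: truncnS_gt.
  exists N => i j Ni Nj; rewrite -(@ltr_pXn2r _ 2)// ?nnegrE ?hnorm_ge0 1?ltW//.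
  apply: le_lt_trans N0; rewrite sqr_hnorm.
  (* The midpoint of [s i] and [s j] lies in the span, so its squared distance to [v] is at least
     [m]; hence |s i - s j|^2 is at most 2 / (i + 1) + 2 / (j + 1), which is where the 4 comes
     from. *)
  have := m_le _ (span_scale 2^-1 (span_add (sP i).1 (sP j).1)).
  have [_ hi] := sP i; have [_ hj] := sP j.
  move: hi hj.
  have hN k : (N <= k)%N -> k.+1%:R^-1 <= N.+1%:R^-1 :> R.
    by move=> Nk; rewrite lef_pV2 ?posrE// ler_nat.
  have := hN i Ni; have := hN j Nj.
  rewrite !dotBl !dotBr !dotZl !dotZr !dotDl !dotDr !(dotC (s _) v) (dotC (s j) (s i)).
  move: (N.+1%:R^-1) (i.+1%:R^-1) (j.+1%:R^-1) => a b c; clearbody m; lra.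
have [w sw] := s_cauchy.
have vsw : hcvg (fun n => v - s n) (v - w).
  by apply: hcvgB sw; exact: hcvg_cst.
have vw_m : hdot E (v - w) (v - w) <= m.
  have h1 : hdot E (v - s n) (v - s n) @[n --> \oo] --> hdot E (v - w) (v - w).
    exact: hcvg_dot.
  have h2 : m + n.+1%:R^-1 @[n --> \oo] --> m.
    rewrite -[X in _ --> X]addr0; apply: cvgD; first exact: cvg_cst.
    exact: cvg_harmonic.
  by apply: ler_cvg_to h1 h2 _; apply: nearW => n; exact/ltW/(sP n).2.
suff vw0 : v = w.
  move/hcvg_hnorm : vsw; rewrite vw0 subrr hnorm0 => /cvgrPdist_lt/(_ e e0)[N _ hN].
  exists (s N); first exact: (sP N).1.
  by have := hN N (leqnn N); rewrite /= sub0r normrN ger0_norm ?hnorm_ge0.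
apply/eqP; rewrite -subr_eq0; apply/eqP; apply: B_basis.2 => f Bf.
set c := hdot E (v - w) f.
(* Each [s n + c *: f] is still in the span, so moving [w] along [f] cannot bring the squared
   distance below [m]; as it is at most [m] at [w], [c] must be 0. *)
have : m <= hdot E (v - w) (v - w) - c ^+ 2.
  have h : hdot E (v - s n - c *: f) (v - s n - c *: f) @[n --> \oo] -->
      hdot E (v - w - c *: f) (v - w - c *: f).
    by apply: hcvg_dot; apply: hcvgD vsw (hcvg_cst _).
  rewrite [leRHS](_ : _ = hdot E (v - w - c *: f) (v - w - c *: f)); last first.
    rewrite /c; move: (v - w) => x.
    rewrite dotBl !dotBr !dotZl !dotZr (dotC f x) (B_basis.1 f f)// eqxx mulr1.
    ring.
  rewrite -(cvg_lim _ h)//; apply: limr_ge; first by apply/cvg_ex; eexists; exact: h.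
  apply: nearW => n; rewrite -addrA -opprD; apply: m_le.
  exact: spanD (sP n).1 Bf.
move=> h; apply/eqP; rewrite -sqrf_eq0 eq_le sqr_ge0 andbT; lra.
Qed.

(** Once the projection fixes a nearby [u] of the span, the residual of [v] is that of [v - u], and
    residuals do not increase norms. *)
Lemma fproj_dense v e : 0 < e -> exists2 F : {fset E}, {subset F <= B} &
  forall G, {subset G <= B} -> {subset F <= G} -> hnorm (v - fproj G v) < e.
Proof.
move=> /(span_dense v)[u /span_fproj[F FB hF] uv]; exists F => // G GB FG.
apply: le_lt_trans uv; apply: le_trans (fproj_residual_le (v - u) GB).
by rewrite fprojB hF// opprB addrA subrK.
Qed.

(** The union of the sets found for each vector works; applied to the values of a finitely valued
    map. *)
Lemma fproj_dense_fin (I : finType) (V : I -> E) e : 0 < e ->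
  exists2 G : {fset E}, {subset G <= B} & forall i, hnorm (V i - fproj G (V i)) < e.
Proof.
move=> e0.
have /choice[F FP] : forall i, exists F : {fset E}, {subset F <= B} /\
    forall G, {subset G <= B} -> {subset F <= G} -> hnorm (V i - fproj G (V i)) < e.
  by move=> i; have [F ? ?] := fproj_dense (V i) e0; exists F.
exists (\bigcup_(i <- enum I) F i)%fset => [f /bigfcupP[i _ fF]|i].
  exact: (FP i).1.
apply: (FP i).2 => [f /bigfcupP[j _ fF]|f fF]; first exact: (FP j).1.
by apply/bigfcupP; exists i; rewrite ?mem_enum.
Qed.

End orthonormal_projection.

(** * Strong measurability *)

Section finite_valued.
Context {d : measure_display} {T : measurableType d}.

(** Measurability is carried by the fibres of the labelling [a] into a finite type, so [Y] can be
    any type, and pairing and arbitrary post-composition preserve the property. *)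
Definition finite_valued (Y : Type) (f : T -> Y) :=
  exists (I : finType) (a : T -> I) (V : I -> Y),
    (forall i, measurable (a @^-1` [set i])) /\ forall x, f x = V (a x).

Lemma finite_valued_preimage (Y : Type) (f : T -> Y) (A : set Y) :
  finite_valued f -> measurable (f @^-1` A).
Proof.
move=> [I [a [V [ma fE]]]].
rewrite (_ : f @^-1` A = \bigcup_(i in [set i | A (V i)]) a @^-1` [set i]).
  by apply: fin_bigcup_measurable => //; exact: finite_finset.
apply/seteqP; split=> [x /=|x [i /= AVi axi]]; last by rewrite fE axi.
by rewrite fE => AVax; exists (a x).
Qed.

Lemma finite_valued_comp (Y Y' : Type) (f : T -> Y) (F : Y -> Y') :
  finite_valued f -> finite_valued (fun x => F (f x)).
Proof.
by move=> [I [a [V [ma fE]]]]; exists I, a, (F \o V); split=> // x; rewrite fE.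
Qed.

Lemma finite_valued_cst (Y : Type) (y : Y) : finite_valued (fun _ : T => y).
Proof.
exists unit, (fun=> tt), (fun=> y); split=> // i.
rewrite (_ : _ @^-1` _ = setT)//; apply/seteqP; split=> // x _ /=.
by case: i.
Qed.

Lemma finite_valued_pair (Y Y' : Type) (f : T -> Y) (g : T -> Y') :
  finite_valued f -> finite_valued g -> finite_valued (fun x => (f x, g x)).
Proof.
move=> [I [a [V [ma fE]]]] [J [b [W [mb gE]]]].
exists (I * J)%type, (fun x => (a x, b x)), (fun z => (V z.1, W z.2)).
split=> [[i j]|x]; last by rewrite fE gE.
rewrite (_ : _ @^-1` _ = a @^-1` [set i] `&` b @^-1` [set j]).
  exact: measurableI.
by apply/seteqP; split=> x /= [-> ->].
Qed.

Lemma finite_valued_ffun (Y : Type) m (f : 'I_m -> T -> bool) (F : {ffun 'I_m -> bool} -> Y) :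
  (forall i, finite_valued (f i)) ->
  finite_valued (fun x => F [ffun i => f i x]).
Proof.
move=> mf; exists {ffun 'I_m -> bool}, (fun x => [ffun i => f i x]), F; split=> // g.
rewrite (_ : _ @^-1` _ = \bigcap_(i in [set: 'I_m]) (f i @^-1` [set g i])).
  by apply: fin_bigcap_measurable => [|i _]; [exact: finite_finset|
     exact: finite_valued_preimage].
apply/seteqP; split=> [x /= <- i _|x /= h]; first by rewrite /= ffunE.
by apply/ffunP => i; rewrite ffunE (h i).
Qed.

Lemma finite_valued_mem (A : set T) : measurable A -> finite_valued (fun x => x \in A).
Proof.
move=> mA; exists bool, (fun x => x \in A), id; split=> // b.
rewrite (_ : _ @^-1` _ = if b then A else ~` A).
  by case: b => //; exact: measurableC.
apply/seteqP; split=> x /=; case: b.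
- exact: set_mem.
- by move/negbT; rewrite notin_setE.
- exact: mem_set.
- exact: memNset.
Qed.

Lemma finite_valued_measurable (R : realType) (f : T -> R) :
  finite_valued f -> measurable_fun setT f.
Proof.
by move=> mf _ Y _; rewrite setTI; exact: finite_valued_preimage.
Qed.

(** Makes the distance from [Z] to a finitely valued approximation measurable before [Z] itself is
    known to be a limit of such maps. *)
Lemma finite_valued_glue (R : realType) (Y : Type) (f : T -> Y) (g : Y -> T -> R) :
  (forall y, measurable_fun setT (g y)) -> finite_valued f ->
  measurable_fun setT (fun x => g (f x) x).
Proof.
move=> mg [I [a [V [ma fE]]]] _ A mA; rewrite setTI.
rewrite (_ : _ @^-1` _ = \bigcup_(i in [set: I]) (a @^-1` [set i] `&` (g (V i) @^-1` A))).
  apply: fin_bigcup_measurable => [|i _]; first exact: finite_finset.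
  by apply: measurableI => //; rewrite -[X in measurable X]setTI; exact: mg.
apply/seteqP; split=> [x /= Ax|x [i _ [/= axi]]]; last by rewrite fE axi.
by exists (a x) => //; split => //=; rewrite -fE.
Qed.

End finite_valued.

Lemma finite_valued_precomp d d' (T : measurableType d) (T' : measurableType d')
    (Y : Type) (phi : T' -> T) (f : T -> Y) : measurable_fun setT phi ->
  finite_valued f -> finite_valued (fun x => f (phi x)).
Proof.
move=> mphi [I [a [V [ma fE]]]]; exists I, (a \o phi), V; split=> // i.
by rewrite comp_preimage -[X in measurable X]setTI; exact: mphi.
Qed.

Section simple_maps.
Context {d : measure_display} {T : measurableType d} {R : realType} {E : hilbertType R}.

(** The sets of a simple map may overlap, so the label of a point is its whole pattern of
    memberships. *)
Lemma simple_apply_finite_valued (s : @simple_map d T R E) :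
  finite_valued (simple_apply s).
Proof.
pose F (g : {ffun 'I_(simple_size s) -> bool}) := \sum_i (g i)%:R *: simple_val i.
rewrite (_ : simple_apply s = fun x =>
    F [ffun i : 'I_(simple_size s) => x \in simple_set i]).
  apply: (finite_valued_ffun (f := fun (i : 'I_(simple_size s)) x =>
    x \in simple_set i) F) => i.
  exact/finite_valued_mem/simple_measurable.
apply/funext => x; apply: eq_bigr => i _; rewrite ffunE.
by rewrite indicE.
Qed.

Lemma finite_valued_simple (f : T -> E) : finite_valued f ->
  exists s : @simple_map d T R E, simple_apply s = f.
Proof.
move=> [I [a [V [ma fE]]]].
exists (SimpleMap (fun i : 'I_#|I| => V (enum_val i)) (fun i => ma (enum_val i))).
apply/funext => x; rewrite fE /simple_apply /= (bigD1 (enum_rank (a x)))//= enum_rankK.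
rewrite indicE mem_set//= scale1r big1 ?addr0// => i ix.
rewrite indicE memNset ?scale0r//= => axi.
by move/eqP: ix; apply; rewrite axi enum_valK.
Qed.

Definition smeas (Z : T -> E) := exists2 t : nat -> T -> E,
  forall n, finite_valued (t n) & forall x, hcvg (t^~ x) (Z x).

Lemma smeas_finite_valued (f : T -> E) : finite_valued f -> smeas f.
Proof. by move=> ff; exists (fun=> f) => // x; exact: hcvg_cst. Qed.

Lemma smeas_dot (Z W : T -> E) : smeas Z -> smeas W ->
  measurable_fun setT (fun x => hdot E (Z x) (W x)).
Proof.
move=> [t mt tZ] [s ms sW].
apply: (measurable_fun_cvg (h := fun n x => hdot E (t n x) (s n x))) => [n|x _].
  apply: finite_valued_measurable.
  exact: (finite_valued_comp (fun z => hdot E z.1 z.2) (finite_valued_pair (mt n) (ms n))).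
exact: hcvg_dot.
Qed.

Lemma smeas_hnorm (Z : T -> E) : smeas Z -> measurable_fun setT (fun x => hnorm (Z x)).
Proof.
move=> [t mt tZ].
apply: (measurable_fun_cvg (h := fun n x => hnorm (t n x))) => [n|x _].
  exact/finite_valued_measurable/finite_valued_comp/mt.
exact: hcvg_hnorm.
Qed.

Lemma smeasD (Z W : T -> E) : smeas Z -> smeas W -> smeas (fun x => Z x + W x).
Proof.
move=> [t mt tZ] [s ms sW]; exists (fun n x => t n x + s n x) => [n|x].
  exact: (finite_valued_comp (fun z => z.1 + z.2) (finite_valued_pair (mt n) (ms n))).
exact: hcvgD.
Qed.

Lemma smeasB (Z W : T -> E) : smeas Z -> smeas W -> smeas (fun x => Z x - W x).
Proof.
move=> [t mt tZ] [s ms sW]; exists (fun n x => t n x - s n x) => [n|x].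
  exact: (finite_valued_comp (fun z => z.1 - z.2) (finite_valued_pair (mt n) (ms n))).
exact: hcvgB.
Qed.

Lemma smeas_cst (v : E) : smeas (fun=> v).
Proof. exact/smeas_finite_valued/finite_valued_cst. Qed.

Lemma smeas_sum I (r : seq I) (Q : pred I) (Z : I -> T -> E) :
  (forall i, Q i -> smeas (Z i)) -> smeas (fun x => \sum_(i <- r | Q i) Z i x).
Proof.
move=> mZ; elim: r => [|i r IH].
  by under eq_fun do rewrite big_nil; exact: smeas_cst.
under eq_fun do rewrite big_cons; case Qi: (Q i) => //.
by apply: smeasD => //; exact: mZ.
Qed.

Lemma smeas_scale (c : E -> R) (Z : T -> E) :
  (forall u (l : E), hcvg u l -> c (u n) @[n --> \oo] --> c l) ->
  smeas Z -> smeas (fun x => c (Z x) *: Z x).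
Proof.
move=> cc [t mt tZ]; exists (fun n x => c (t n x) *: t n x) => [n|x].
  exact: (finite_valued_comp (fun z => c z *: z) (mt n)).
by apply: hcvgZ => //; exact: cc.
Qed.

(** Each approximation is replaced by 0 where its norm exceeds twice that of [Z]. Where [Z] vanishes
    this leaves only the value 0; elsewhere it eventually changes nothing. The bound gives access to
    dominated convergence. *)
Lemma smeas_dominated (Z : T -> E) : smeas Z -> exists t : nat -> T -> E,
  [/\ forall n, finite_valued (t n), forall x, hcvg (t^~ x) (Z x) &
      forall n x, hnorm (t n x) <= 2 * hnorm (Z x)].
Proof.
move=> mZ; have [t mt tZ] := mZ.
pose A n := [set x | hnorm (t n x) <= 2 * hnorm (Z x)].
have mA n : measurable (A n).
  rewrite -[A n]setTI; apply: measurable_fun_le => //.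
    exact/smeas_hnorm/smeas_finite_valued.
  by apply: measurable_funM => //; exact: smeas_hnorm.
exists (fun n x => (x \in A n)%:R *: t n x); split=> [n|x|n x].
- exact: (finite_valued_comp (fun z : bool * E => z.1%:R *: z.2)
    (finite_valued_pair (finite_valued_mem (mA n)) (mt n))).
- have [Z0|Z0] := eqVneq (hnorm (Z x)) 0.
    rewrite (_ : (fun _ => _) = fun=> Z x); first exact: hcvg_cst.
    apply/funext => n; rewrite (hnorm_eq0 Z0).
    have [/set_mem|_] := boolP (x \in A n); rewrite ?scale0r// scale1r /A/= Z0 mulr0 => t0.
    by apply: hnorm_eq0; apply/eqP; rewrite eq_le t0 hnorm_ge0.
  have Z_gt0 : 0 < hnorm (Z x) by rewrite lt_neqAle eq_sym Z0 hnorm_ge0.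
  apply/hcvgP => e e0.
  have /hcvgP/(_ e e0)[N1 h1] := tZ x.
  (* Within distance |Z x| of [Z x] the norm is below 2 |Z x|, so past [N2] the truncation is
     inactive. *)
  have /hcvgP/(_ _ Z_gt0)[N2 h2] := tZ x.
  exists (maxn N1 N2) => n; rewrite geq_max => /andP[n1 n2].
  rewrite mem_set ?scale1r ?h1//.
  rewrite /A /= mulr2n mulrDl mul1r -lerBlDr; apply: le_trans (ltW (h2 n n2)).
  exact: le_trans (ler_norm _) (ler_dist_hnorm _ _).
- have [/set_mem h|_] := boolP (x \in A n); first by rewrite scale1r.
  by rewrite scale0r hnorm0 mulr_ge0 ?hnorm_ge0.
Qed.

Fixpoint greedy_approx (v : nat -> E) (Z : T -> E) (n : nat) (x : T) : E :=
  if n is m.+1 then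
    if hnorm (Z x - v m) < hnorm (Z x - greedy_approx v Z m x) then v m
    else greedy_approx v Z m x
  else 0.

(** [greedy_approx] follows the nearest point among 0, [v 0], ..., [v (n - 1)]: its distance to
    [Z x] never increases and drops below e once a listed point is that close. Only distances to
    fixed vectors have to be measurable. *)
Lemma smeas_dense_values (v : nat -> E) (Z : T -> E) :
  (forall u, measurable_fun setT (fun x => hnorm (Z x - u))) ->
  (forall x e, 0 < e -> exists n, hnorm (Z x - v n) < e) ->
  smeas Z.
Proof.
move=> mZ vZ.
pose t := greedy_approx v Z.
exists t => [n|x].
  elim: n => [|n IH]; first exact: finite_valued_cst.
  pose A := [set x | hnorm (Z x - v n) < hnorm (Z x - t n x)].
  have mA : measurable A.
    rewrite (_ : A = ~` [set x | hnorm (Z x - t n x) <= hnorm (Z x - v n)]).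
      apply/measurableC; rewrite -[X in measurable X]setTI.
      apply: measurable_fun_le => //.
      exact: (finite_valued_glue (g := fun u x => hnorm (Z x - u))).
    by apply/seteqP; split=> x /=; rewrite /A/= ltNge => /negP.
  rewrite (_ : t n.+1 = fun x => if x \in A then v n else t n x); last first.
    apply/funext => x; rewrite /t/=; have [/set_mem xA|xA] := boolP (x \in A).
      by rewrite ifT.
    by rewrite ifF//; apply/negbTE; apply: contra xA => /mem_set.
  exact: (finite_valued_comp (fun z : bool * E => if z.1 then v n else z.2)
    (finite_valued_pair (finite_valued_mem mA) IH)).
have t_decr m n : (m <= n)%N -> hnorm (Z x - t n x) <= hnorm (Z x - t m x).
  elim: n => [|n IH]; first by rewrite leqn0 => /eqP->.
  rewrite leq_eqVlt ltnS => /orP[/eqP->//|/IH h]; rewrite /t/=.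
  by apply: le_trans h; case: ifPn => // /ltW.
apply/hcvgP => e e0; have [N hN] := vZ x e e0.
exists N.+1 => n Nn; rewrite hnormBC; apply: le_lt_trans (t_decr _ _ Nn) _; rewrite /t/=.
by case: ifPn => //; rewrite -leNgt => /le_lt_trans; apply.
Qed.

End simple_maps.

Lemma smeas_precomp d d' (T : measurableType d) (T' : measurableType d')
    (R : realType) (E : hilbertType R) (phi : T' -> T) (Z : T -> E) :
  measurable_fun setT phi -> smeas Z -> smeas (fun x => Z (phi x)).
Proof.
move=> mphi [t mt tZ]; exists (fun n x => t n (phi x)) => // n.
exact: finite_valued_precomp.
Qed.

(** * Bochner integrals *)

Section real_integrable.
Context {d : measure_display} {T : measurableType d} {R : realType}.
Variables (mu : {measure set T -> \bar R}) (D : set T).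
Hypothesis mD : measurable D.
Implicit Types f g : T -> R.
Local Notation intble f := (mu.-integrable D (EFin \o f)).

Lemma integrable_le f g : measurable_fun D f -> intble g ->
  (forall x, D x -> `|f x| <= g x) -> intble f.
Proof.
move=> mf ig fg; apply: le_integrable ig => //; first exact/measurable_EFinP.
by move=> x Dx /=; rewrite lee_fin (le_trans (fg x Dx))// ler_norm.
Qed.

Lemma integrableD_EFin f g : intble f -> intble g -> intble (fun x => f x + g x).
Proof. by move=> i1 i2; have := integrableD mD i1 i2; exact. Qed.

Lemma integrableB_EFin f g : intble f -> intble g -> intble (fun x => f x - g x).
Proof. by move=> i1 i2; have := integrableB mD i1 i2; exact. Qed.

Lemma integrableZ_EFin a f : intble f -> intble (fun x => a * f x).
Proof. by move=> i1; have := integrableZl mD a i1; exact. Qed.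

Lemma integral_dominated_cvg0 (f : nat -> T -> R) g :
  (forall n, measurable_fun D (f n)) -> intble g ->
  (forall n x, D x -> `|f n x| <= g x) ->
  (forall x, D x -> f n x @[n --> \oo] --> (0 : R)) ->
  (\int[mu]_(x in D) (f n x)%:E)%E @[n --> \oo] --> 0%E.
Proof.
move=> mf ig fg f0.
have [||||_ _] := @dominated_convergence _ _ _ mu D mD (fun n => EFin \o f n) (cst 0%E) _ _ _ _ ig.
- by move=> n; exact/measurable_EFinP/mf.
- exact: measurable_cst.
- by apply: aeW => x Dx; apply: cvg_EFin; [exact: nearW|exact: f0].
- by apply: aeW => x n Dx; rewrite /= lee_fin fg.
- by rewrite integral_cst// mul0e; exact.
Qed.

End real_integrable.

Section bochner.
Context {d : measure_display} {T : measurableType d} {R : realType} {E : hilbertType R}.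
Variables (P : probability T R) (D : set T).
Hypothesis mD : measurable D.
Local Notation intble f := (P.-integrable D (EFin \o f)).
Implicit Types (Z : T -> E) (s : @simple_map d T R E).

Lemma finite_valued_integrable (f : T -> R) : finite_valued f -> intble f.
Proof.
move=> ff; apply: measurable_bounded_integrable => //.
- by apply: le_lt_trans (probability_le1 P mD) _; rewrite ltry.
- exact: (measurable_funS measurableT (@subsetT _ _) (finite_valued_measurable ff)).
- have [I [a [V [_ fE]]]] := ff; exists (\sum_i `|V i|); split; first exact: num_real.
  move=> M VM x _ /=; rewrite fE (le_trans _ (ltW VM))//.
  by rewrite (bigD1 (a x))//= lerDl sumr_ge0.
Qed.

Lemma simple_apply_dot_integrable s (v : E) : intble (fun x => hdot E v (simple_apply s x)).
Proof.
apply: finite_valued_integrable.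
exact: (finite_valued_comp _ (simple_apply_finite_valued s)).
Qed.

Lemma simple_integral_dot s (v : E) :
  \int[P]_(x in D) hdot E v (simple_apply s x) = hdot E v (simple_integral P D s).
Proof.
rewrite /Rintegral (_ : integral _ _ _ =
    \int[P]_(x in D) \sum_(i < simple_size s)
      (hdot E v (simple_val i))%:E * (\1_(simple_set i) x)%:E)%E; last first.
  apply: eq_integral => x _; rewrite dot_sumr -sumEFin; apply: eq_bigr => i _.
  by rewrite dotZr mulrC EFinM.
have i1 (i : 'I_(simple_size s)) : P.-integrable D (EFin \o \1_(simple_set i)).
  apply: finite_valued_integrable.
  rewrite (_ : \1_(simple_set i) = fun x => (x \in simple_set i)%:R).
    exact: (finite_valued_comp (fun b : bool => b%:R)
      (finite_valued_mem (simple_measurable i))).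
  by apply/funext => x; rewrite indicE.
rewrite integral_sum//; last by move=> i; apply: integrableZl => //; exact: i1.
rewrite dot_sumr -sum_fine => [|i _]; last first.
  by apply: integrable_fin_num => //; apply: integrableZl => //; exact: i1.
apply: eq_bigr => i _; rewrite integralZl//; last exact: i1.
rewrite fineM//; last exact: (integrable_fin_num mD (i1 i)).
by rewrite dotZr mulrC /= integral_indic//; [rewrite setIC|exact: simple_measurable].
Qed.

(** Pairing the difference of the two integrals with itself turns the claim into one about scalar
    integrals, which avoids a common refinement of the two families of sets. *)
Lemma simple_integral_dist s1 s2 :
  hnorm (simple_integral P D s1 - simple_integral P D s2) <=
  \int[P]_(x in D) hnorm (simple_apply s1 x - simple_apply s2 x).
Proof.
set v := _ - _; have [->|v0] := eqVneq (hnorm v) 0.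
  by apply: Rintegral_ge0 => x _; exact: hnorm_ge0.
have v_gt0 : 0 < hnorm v by rewrite lt_neqAle eq_sym v0 hnorm_ge0.
have inorm : intble (fun x => hnorm (simple_apply s1 x - simple_apply s2 x)).
  apply: finite_valued_integrable.
  exact: (finite_valued_comp (fun z => hnorm (z.1 - z.2)) (finite_valued_pair
    (simple_apply_finite_valued s1) (simple_apply_finite_valued s2))).
rewrite -(ler_pM2l v_gt0) -expr2 sqr_hnorm {2}/v dotBr -!simple_integral_dot.
rewrite -RintegralB ?simple_apply_dot_integrable//; try exact: simple_apply_dot_integrable.
rewrite -RintegralZl//; apply: le_Rintegral => //.
- by apply: integrableB_EFin => //; exact: simple_apply_dot_integrable.
- exact: integrableZ_EFin.
- move=> x _; rewrite -dotBr; apply: le_trans (ler_norm _) _.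
  exact: cauchy_schwarz_dot.
Qed.

Lemma smeas_dot_integrable Z (v : E) : smeas Z -> intble (fun x => hnorm (Z x)) ->
  intble (fun x => hdot E v (Z x)).
Proof.
move=> mZ iZ; apply: (@integrable_le _ _ _ _ _ _ _ (fun x => hnorm v * hnorm (Z x))) => //.
- apply: (measurable_funS measurableT) => //; apply: smeas_dot => //; exact: smeas_cst.
- exact: integrableZ_EFin.
- by move=> x _; exact: cauchy_schwarz_dot.
Qed.

(** The pairing is exact for simple maps, and the error in passing to [Z] is at most |v| times the
    L1 distance. Being true of every [h] in the relation, it applies to the one that [xget]
    selects. *)
Lemma bochner_integral_dot Z (h v : E) : smeas Z -> intble (fun x => hnorm (Z x)) ->
  is_bochner_integral P D Z h -> \int[P]_(x in D) hdot E v (Z x) = hdot E v h.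
Proof.
move=> mZ iZ [s [_ s0 sh]].
have iZs n : intble (fun x => hnorm (Z x - simple_apply (s n) x)).
  apply: (@integrable_le _ _ _ _ _ _ _ (fun x => hnorm (Z x) + hnorm (simple_apply (s n) x))) => //.
  - apply: (measurable_funS measurableT) => //; apply/smeas_hnorm/smeasB => //.
    exact/smeas_finite_valued/simple_apply_finite_valued.
  - apply: integrableD_EFin => //; apply: finite_valued_integrable.
    exact: (finite_valued_comp _ (simple_apply_finite_valued (s n))).
  - move=> x _; rewrite ger0_norm ?hnorm_ge0//.
    by have := ler_hnormD (Z x) (- simple_apply (s n) x); rewrite hnorm_opp.
have a0 : \int[P]_(x in D) hnorm (Z x - simple_apply (s n) x) @[n --> \oo] --> (0 : R).
  exact: fine_cvg s0.
have h1 : hdot E v (simple_integral P D (s n)) @[n --> \oo] --> hdot E v h.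
  exact: hcvg_dot (hcvg_cst v) sh.
apply/esym; apply: cvg_unique h1 _ => //.
apply/cvgrPdist_le => e e0.
have : hnorm v * \int[P]_(x in D) hnorm (Z x - simple_apply (s n) x) @[n --> \oo] -->
  hnorm v * 0 by apply: cvgMr.
rewrite mulr0 => /cvgrPdist_le/(_ e e0)[N _ hN]; exists N => // n Nn /=.
apply: le_trans (hN n Nn); rewrite /= sub0r normrN [leRHS]ger0_norm; last first.
  by rewrite mulr_ge0 ?hnorm_ge0// Rintegral_ge0// => x _; exact: hnorm_ge0.
rewrite -simple_integral_dot -RintegralB//; last 2 first.
- exact: smeas_dot_integrable.
- exact: simple_apply_dot_integrable.
have iB : intble (fun x => hdot E v (Z x) - hdot E v (simple_apply (s n) x)).
  by apply: integrableB_EFin => //;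
    [exact: smeas_dot_integrable|exact: simple_apply_dot_integrable].
apply: le_trans (le_normr_Rintegral mD iB) _; rewrite -RintegralZl//.
apply: le_Rintegral => //.
- exact: (integrable_norm iB).
- exact: integrableZ_EFin.
- by move=> x _; rewrite -dotBr; exact: cauchy_schwarz_dot.
Qed.

(** Approximations dominated by 2 |Z| converge in L1, with 3 |Z| as dominating function, so their
    integrals form a Cauchy sequence and completeness gives the value. *)
Lemma bochner_integral_exists Z : smeas Z -> intble (fun x => hnorm (Z x)) ->
  exists h, is_bochner_integral P D Z h.
Proof.
move=> mZ iZ; have [t [mt tZ tle]] := smeas_dominated mZ.
have /choice[s sE] : forall n, exists s : @simple_map d T R E, simple_apply s = t n.
  by move=> n; exact: finite_valued_simple.
have mZt n : measurable_fun D (fun x => hnorm (Z x - t n x)).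
  apply: (measurable_funS measurableT) => //; apply/smeas_hnorm/smeasB => //.
  exact: smeas_finite_valued.
have Zt_le n x : `|hnorm (Z x - t n x)| <= 3 * hnorm (Z x).
  rewrite ger0_norm ?hnorm_ge0//.
  by have := ler_hnormD (Z x) (- t n x); have := tle n x; rewrite hnorm_opp; lra.
have iZ3 : intble (fun x => 3 * hnorm (Z x)) by exact: integrableZ_EFin.
have cvg0 : (\int[P]_(x in D) (hnorm (Z x - t n x))%:E)%E @[n --> \oo] --> 0%E.
  apply: integral_dominated_cvg0 iZ3 _ _ => // x _.
  by under eq_fun do rewrite hnormBC; exact: tZ.
have [h hP] : exists h, hcvg (fun n => simple_integral P D (s n)) h.
  apply: hcvg_cauchy => e e0.
  have e20 : 0 < e / 2 by rewrite divr_gt0.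
  have /cvgrPdist_lt/(_ _ e20)[N _ hN] :
    \int[P]_(x in D) hnorm (Z x - t n x) @[n --> \oo] --> (0 : R) by exact: fine_cvg cvg0.
  exists N => m n Nm Nn; apply: le_lt_trans (simple_integral_dist _ _) _.
  have := hN m Nm; have := hN n Nn; rewrite /= !sub0r !normrN.
  have iZt k : intble (fun x => hnorm (Z x - t k x)).
    by apply: integrable_le iZ3 _.
  rewrite !ger0_norm; try by apply: Rintegral_ge0 => x _; exact: hnorm_ge0.
  move=> hn hm.
  have iD : intble (fun x => hnorm (Z x - t m x) + hnorm (Z x - t n x)).
    by apply: integrableD_EFin.
  apply: le_lt_trans (_ : \int[P]_(x in D) (hnorm (Z x - t m x) + hnorm (Z x - t n x)) < e).
    apply: le_Rintegral => // [|x _].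
      apply: finite_valued_integrable.
      exact: (finite_valued_comp (fun z => hnorm (z.1 - z.2)) (finite_valued_pair
        (simple_apply_finite_valued (s m)) (simple_apply_finite_valued (s n)))).
    rewrite !sE; have := ler_hnormB (t m x) (Z x) (t n x).
    by rewrite (hnormBC (t m x) (Z x)).
  rewrite RintegralD//; move: hn hm; rewrite /Rintegral; lra.
exists h, s; split=> [n||//]; first by rewrite sE.
by under eq_fun do under eq_integral do rewrite sE.
Qed.

Lemma is_bochner_integral_ext Z W (h : E) : (forall x, D x -> Z x = W x) ->
  is_bochner_integral P D Z h -> is_bochner_integral P D W h.
Proof.
move=> ZW [s [ms s0 sh]]; exists s; split => //.
- by move=> n; apply: eq_measurable_fun (ms n) => x; rewrite inE => /ZW ->.
- rewrite (_ : (fun _ => _) = fun n =>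
    (\int[P]_(x in D) (hnorm (Z x - simple_apply (s n) x))%:E)%E)//.
  by apply/funext => n; apply: eq_integral => x; rewrite inE => /ZW ->.
Qed.

End bochner.

Lemma Rintegral_cst_probability d (T : measurableType d) (R : realType)
  (P : probability T R) (r : R) : \int[P]_w r = r.
Proof.
rewrite Rintegral_cst//; have -> : (P : {measure set T -> \bar R}) setT = 1%E.
  exact: probability_setT.
by rewrite mulr1.
Qed.

(** * The trace of the covariance operator *)

Section trace.
Context {d : measure_display} {T : measurableType d} {R : realType} {E : hilbertType R}.
Variables (P : probability T R) (D : set T).
Hypothesis mD : measurable D.
Local Notation intble f := (P.-integrable D (EFin \o f)).
Variable Z : T -> E.
Hypothesis mZ : smeas Z.
Hypothesis iZ2 : intble (fun x => hdot E (Z x) (Z x)).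

Lemma smeas_measurable_dot (W : T -> E) (v : E) : smeas W ->
  measurable_fun D (fun x => hdot E (W x) v).
Proof.
move=> mW; apply: (measurable_funS measurableT) => //.
by apply: smeas_dot => //; exact: smeas_cst.
Qed.

Lemma sqr_integrable_hnorm : intble (fun x => hnorm (Z x)).
Proof.
apply: (@integrable_le _ _ _ _ _ _ _ (fun x => 1 + hdot E (Z x) (Z x))) => //.
- by apply: (measurable_funS measurableT) => //; exact: smeas_hnorm.
- by apply: integrableD_EFin => //; exact/finite_valued_integrable/finite_valued_cst.
- move=> x _; rewrite ger0_norm ?hnorm_ge0// -sqr_hnorm.
  by have := sqr_ge0 (hnorm (Z x) - 1); have := hnorm_ge0 (Z x); lra.
Qed.

Lemma sqr_dot_integrable (e : E) : intble (fun x => hdot E (Z x) e ^+ 2).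
Proof.
apply: (@integrable_le _ _ _ _ _ _ _ (fun x => hdot E e e * hdot E (Z x) (Z x))) => //.
- exact/measurable_funX/smeas_measurable_dot.
- exact: integrableZ_EFin.
- move=> x _; rewrite ger0_norm ?sqr_ge0// -!sqr_hnorm -exprMn mulrC.
  rewrite -[leLHS]real_normK ?num_real// ler_pXn2r ?nnegrE ?mulr_ge0 ?hnorm_ge0//.
  exact: cauchy_schwarz_dot.
Qed.

Lemma smeas_L2_approx e : 0 < e -> exists t : T -> E,
  [/\ finite_valued t, intble (fun x => hdot E (Z x - t x) (Z x - t x)) &
    \int[P]_(x in D) hdot E (Z x - t x) (Z x - t x) < e].
Proof.
move=> e0; have [t [mt tZ tle]] := smeas_dominated mZ.
have mZt n : measurable_fun D (fun x => hdot E (Z x - t n x) (Z x - t n x)).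
  apply: (measurable_funS measurableT) => //.
  by apply: smeas_dot; apply: smeasB => //; exact: smeas_finite_valued.
(* 9 is the square of 1 + 2, since [t n] is dominated by 2 |Z|. *)
have Zt_le n x : D x ->
    `|hdot E (Z x - t n x) (Z x - t n x)| <= 9 * hdot E (Z x) (Z x).
  move=> _; rewrite ger0_norm ?dot_ge0// -!sqr_hnorm (_ : 9 = 3 ^+ 2); last by ring.
  rewrite -exprMn ler_pXn2r ?nnegrE ?mulr_ge0 ?hnorm_ge0//.
  by have := ler_hnormD (Z x) (- t n x); have := tle n x; rewrite hnorm_opp; lra.
have iZ9 : intble (fun x => 9 * hdot E (Z x) (Z x)) by exact: integrableZ_EFin.
have cvg0 : (\int[P]_(x in D) (hdot E (Z x - t n x) (Z x - t n x))%:E)%E @[n --> \oo] --> 0%E.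
  apply: integral_dominated_cvg0 iZ9 _ _ => // x _.
  rewrite -(mulr0 0); under eq_fun do rewrite -sqr_hnorm expr2 hnormBC.
  by apply: cvgM; exact: tZ.
have /cvgrPdist_lt/(_ _ e0)[N _ hN] :
    \int[P]_(x in D) hdot E (Z x - t n x) (Z x - t n x) @[n --> \oo] --> (0 : R).
  exact: fine_cvg cvg0.
exists (t N); split=> //; first by apply: integrable_le iZ9 (Zt_le N).
have := hN N (leqnn N); rewrite /= sub0r normrN ger0_norm//.
by apply: Rintegral_ge0 => x _; exact: dot_ge0.
Qed.

Variable B : set E.
Hypothesis B_basis : orthonormal_basis B.

Lemma Rintegral_sqr_fproj (F : {fset E}) : {subset F <= B} ->
  \int[P]_(x in D) hdot E (Z x) (Z x) =
  \sum_(e <- F) \int[P]_(x in D) hdot E (Z x) e ^+ 2 +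
  \int[P]_(x in D) hdot E (Z x - fproj F (Z x)) (Z x - fproj F (Z x)).
Proof.
move=> FB.
have iS : intble (fun x => \sum_(e <- F) hdot E (Z x) e ^+ 2).
  rewrite (_ : EFin \o _ = fun x => \sum_(e <- F) (hdot E (Z x) e ^+ 2)%:E)%E; last first.
    by apply/funext => x; rewrite /= sumEFin.
  by apply: integrable_sum => // e _; apply: sqr_dot_integrable.
rewrite (_ : \sum_(e <- F) _ = \int[P]_(x in D) \sum_(e <- F) hdot E (Z x) e ^+ 2).
  under [in X in _ + X]eq_Rintegral => x _ do rewrite (fproj_pythagoras B_basis _ FB).
  by rewrite RintegralB// addrC subrK.
rewrite /Rintegral; under [in RHS]eq_integral do rewrite -sumEFin.
rewrite integral_sum//; last by move=> e; exact: sqr_dot_integrable.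
by rewrite -sum_fine// => e _; apply: integrable_fin_num => //; exact: sqr_dot_integrable.
Qed.

(** The sum over [B] is a supremum over finite subsets: each finite subset obeys Bessel's
    inequality, and for the converse one finite subset with a small integrated residual suffices. *)
Lemma esum_Rintegral_sqr_dot :
  (\esum_(e in B) (\int[P]_(x in D) hdot E (Z x) e ^+ 2)%:E)%E =
  (\int[P]_(x in D) hdot E (Z x) (Z x))%:E.
Proof.
apply/eqP; rewrite eq_le; apply/andP; split.
  apply: ge_ereal_sup => _ [A [finA AB] <-]; rewrite fsbig_finite//= sumEFin lee_fin.
  rewrite (@Rintegral_sqr_fproj (fset_set A)); last first.
    by move=> e; rewrite in_fset_set// => /set_mem/AB/mem_set.
  by rewrite lerDl; apply: Rintegral_ge0 => x _; exact: dot_ge0.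
apply/lee_addgt0Pr => e e0.
(* The squared residual of [Z] will be at most 2 |Z - t|^2 + 2 (e / 4), and each of the two terms
   integrates to at most e / 2. *)
have e40 : 0 < e / 4 by rewrite divr_gt0.
have [t [ft it te]] := smeas_L2_approx e40.
have [I [a [V [_ tE]]]] := ft.
have s0 : 0 < Num.sqrt (e / 4) by rewrite sqrtr_gt0.
have [F FB hF] := fproj_dense_fin B_basis V s0.
apply: (@le_trans _ _ ((\sum_(f <- F) \int[P]_(x in D) hdot E (Z x) f ^+ 2)%:E + e%:E)%E).
  rewrite -EFinD lee_fin (Rintegral_sqr_fproj FB) lerD2l.
  have i1 : intble (fun x => 2 * hdot E (Z x - t x) (Z x - t x) + 2 * (e / 4)).
    apply: integrableD_EFin => //; first exact: integrableZ_EFin.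
    exact/finite_valued_integrable/finite_valued_cst.
  have mr : measurable_fun D (fun x => hdot E (Z x - fproj F (Z x)) (Z x - fproj F (Z x))).
    under eq_fun do rewrite (fproj_pythagoras B_basis _ FB).
    apply: measurable_funB; last first.
      by apply: measurable_sum => f; exact/measurable_funX/smeas_measurable_dot.
    by apply: (measurable_funS measurableT) => //; exact: smeas_dot.
  have r_le x : hdot E (Z x - fproj F (Z x)) (Z x - fproj F (Z x)) <=
      2 * hdot E (Z x - t x) (Z x - t x) + 2 * (e / 4).
    rewrite -!sqr_hnorm -(sqr_sqrtr (ltW e40)).
    have h1 := fproj_residual_le B_basis (Z x - t x) FB.
    have h2 := ltW (hF (a x)); rewrite -tE in h2.
    have h3 : hnorm (Z x - fproj F (Z x)) <= hnorm (Z x - t x) + Num.sqrt (e / 4).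
      apply: le_trans (lerD h1 h2).
      have := ler_hnormD (Z x - t x - fproj F (Z x - t x)) (t x - fproj F (t x)).
      by rewrite fprojB opprB addrACA subrK [_ - _ - fproj F (t x)]addrAC subrr sub0r.
    apply: (@le_trans _ _ ((hnorm (Z x - t x) + Num.sqrt (e / 4)) ^+ 2)).
      by rewrite ler_pXn2r// nnegrE ?addr_ge0 ?hnorm_ge0 ?sqrtr_ge0.
    by have := sqr_ge0 (hnorm (Z x - t x) - Num.sqrt (e / 4)); lra.
  apply: (@le_trans _ _ (\int[P]_(x in D) (2 * hdot E (Z x - t x) (Z x - t x) + 2 * (e / 4)))).
    apply: le_Rintegral => //.
    by apply: integrable_le i1 _ => // x _; rewrite ger0_norm ?dot_ge0.
  rewrite RintegralD//; last 2 first.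
  - exact: integrableZ_EFin.
  - exact/finite_valued_integrable/finite_valued_cst.
  rewrite RintegralZl// Rintegral_cst//.
  have PD : fine (P D) <= 1 by rewrite -lee_fin fineK ?fin_num_measure// probability_le1.
  have := ler_wpM2l (ltW e40) PD; move: te; lra.
rewrite leeD2r//; apply: esum_ge; exists [set` F].
  by split=> // f /mem_set; rewrite inE => /FB/set_mem.
by rewrite fsbig_finite//= set_fsetK sumEFin.
Qed.

End trace.

Section covariance.
Context {d : measure_display} {T : measurableType d} {R : realType} {E : hilbertType R}.
Variables (P : probability T R) (D : set T).
Hypothesis mD : measurable D.
Variables Z W : T -> E.
Hypothesis mZ : smeas Z.
Hypothesis iZ2 : P.-integrable D (EFin \o (fun x => hdot E (Z x) (Z x))).
Hypothesis WZ : forall x, D x -> Z x = W x.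
Let C (f : E) : E := bochner_integral P D (fun x => tensor (W x) (W x) f).

(** The operator is built from [W], about which nothing is known outside [D]; [Z] is its strongly
    measurable substitute. Pairing with [e] passes inside the Bochner integral because the integrand
    has norm at most |e| |Z|^2. *)
Lemma covariance_dot (e : E) :
  hdot E (C e) e = \int[P]_(x in D) hdot E (Z x) e ^+ 2.
Proof.
pose Y x := hdot E (Z x) e *: Z x.
have mY : smeas Y.
  by apply: (smeas_scale (c := fun z => hdot E z e)) => // u l ul;
    exact: hcvg_dot ul (hcvg_cst e).
have iY : P.-integrable D (EFin \o (fun x => hnorm (Y x))).
  apply: (@integrable_le _ _ _ _ _ _ _ (fun x => hnorm e * hdot E (Z x) (Z x))) => //.
  - by apply: (measurable_funS measurableT) => //; exact: smeas_hnorm.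
  - exact: integrableZ_EFin.
  - move=> x _; rewrite ger0_norm ?hnorm_ge0// hnormZ -sqr_hnorm.
    rewrite expr2 mulrCA mulrC ler_wpM2l ?hnorm_ge0// mulrC.
    exact: cauchy_schwarz_dot.
have CP : is_bochner_integral P D Y (C e).
  apply: (@is_bochner_integral_ext _ _ _ _ _ _ (fun x => tensor (W x) (W x) e)).
    by move=> x Dx; rewrite /tensor -WZ.
  apply: xgetPex; have [h hP] := bochner_integral_exists mD mY iY.
  exists h; apply: is_bochner_integral_ext hP => x Dx.
  by rewrite /tensor -WZ.
rewrite dotC -(bochner_integral_dot mD e mY iY CP).
by apply: eq_Rintegral => x _; rewrite dotZr dotC.
Qed.

(* Positivity of the trace rules out the junk value [set0] of [xget], for which
   the sum would be empty. *)
Lemma trace_covariance : 0 < fine (trace C) ->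
  fine (trace C) = \int[P]_(x in D) hdot E (Z x) (Z x).
Proof.
rewrite /trace; under eq_esum do rewrite covariance_dot.
case: xgetP => [B _ B_basis|_]; last by rewrite esum_set0 ltxx.
by rewrite esum_Rintegral_sqr_dot.
Qed.

End covariance.

(** * Independence *)

Section independence.
Context {dO d1 d2 : measure_display} {Omega : measurableType dO}
  {T1 : measurableType d1} {T2 : measurableType d2} {R : realType}.
Variables (P : probability Omega R) (mu : probability T2 R).
Variables (a : Omega -> T1) (b : Omega -> T2).
Hypotheses (ma : measurable_fun setT a) (mb : measurable_fun setT b).
Hypothesis indep : forall A B, measurable A -> measurable B ->
  (P (a @^-1` A `&` b @^-1` B) = P (a @^-1` A) * mu B)%E.

Let a_mixin := isMeasurableFun.Build _ _ _ _ _ ma.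
Let a_pack : {mfun Omega >-> T1} := HB.pack a a_mixin.

(** A measure on the product is determined by rectangles, so the joint law of [a] and [b] is the
    product of their laws; Tonelli's theorem then gives the iterated integral. *)
Lemma indep_tonelli (f : T1 * T2 -> \bar R) : measurable_fun setT f ->
  (forall z, 0 <= f z)%E ->
  (\int[P]_w f (a w, b w) = \int[P]_w \int[mu]_y f (a w, y))%E.
Proof.
move=> mf f0.
have mab : measurable_fun setT (fun w => (a w, b w)) by exact: measurable_fun_pair.
transitivity (\int[pushforward P (fun w => (a w, b w))]_z f z)%E.
  by rewrite (ge0_integral_pushforward mab P measurableT mf).
transitivity (\int[distribution P a_pack \x mu]_z f z)%E.
  apply/esym; apply: eq_measure_integral => A mA _.
  exact: product_measure_unique.
rewrite fubini_tonelli1//.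
have mF : measurable_fun setT (fubini_F mu f) by exact: measurable_fun_fubini_tonelli_F.
rewrite ge0_integral_pushforward// => y _.
exact: integral_ge0.
Qed.

Lemma measurable_indep_section (f : T1 * T2 -> \bar R) : measurable_fun setT f ->
  (forall z, 0 <= f z)%E -> measurable_fun setT (fun w => \int[mu]_y f (a w, y))%E.
Proof.
move=> mf f0; apply: (measurableT_comp (f := fubini_F mu f)) => //.
exact: measurable_fun_fubini_tonelli_F.
Qed.

End independence.

Section iid_prefix.
Context {dO dT : measure_display} {Omega : measurableType dO}
  {T : measurableType dT} {R : realType}.
Variables (P : probability Omega R) (mu : probability T R) (n : nat).
Variable X : 'I_n -> Omega -> T.
Hypothesis X_iid : iid P X mu.
Variable J : {set 'I_n}.

(* [prefix_space] is Omega with the sigma-algebra generated by the X i, i in J: a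
   function of these and of X j then lives on the product [prefix_space * T]. *)
Definition cylinders : set (set Omega) :=
  [set C | exists A : 'I_n -> set T, (forall i, measurable (A i)) /\
     C = \bigcap_(i in [set` J]) (X i @^-1` A i)].

Definition prefix_space := g_sigma_algebraType cylinders.

Lemma cylinders_measurable : cylinders `<=` measurable.
Proof.
move=> _ [A [mA ->]]; apply: fin_bigcap_measurable => // i _.
by rewrite -[X in measurable X]setTI; have [mX _ _] := X_iid; exact: mX.
Qed.

Lemma cylinders_setI : setI_closed cylinders.
Proof.
move=> _ _ [A [mA ->]] [B [mB ->]]; exists (fun i => A i `&` B i).
split; first by move=> i; exact: measurableI.
by rewrite -bigcapI; apply: eq_bigcapr => i _; rewrite preimage_setI.
Qed.

Lemma cylinders_setT : cylinders setT.
Proof.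
exists (fun=> setT); split; first by move=> i; exact: measurableT.
by rewrite bigcapT.
Qed.

Lemma measurable_to_prefix : measurable_fun setT (id : Omega -> prefix_space).
Proof.
move=> _ A mA; rewrite setTI preimage_id.
by apply: smallest_sub mA; [exact: sigma_algebra_measurable|exact: cylinders_measurable].
Qed.

Lemma measurable_prefix i : i \in J ->
  measurable_fun (setT : set prefix_space) (X i).
Proof.
move=> iJ _ A mA; rewrite setTI; apply: sub_sigma_algebra.
exists (fun k => if k == i then A else setT); split.
  by move=> k; case: ifP.
apply/seteqP; split=> [w Aw k /= _|w]; first by case: eqP => // ->.
by move=> /(_ i iJ); rewrite /= eqxx.
Qed.

(** Both sides are finite measures in [C] that agree on the cylinders; these are stable under
    intersection and generate the sigma-algebra. *)
Lemma iid_prefix_indep j (C : set prefix_space) (B : set T) : j \notin J ->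
  measurable C -> measurable B ->
  (P (C `&` X j @^-1` B) = P C * mu B)%E.
Proof.
move=> jJ mC mB; have [mX X_law X_indep] := X_iid.
have mXB i D : measurable D -> measurable (X i @^-1` D).
  by move=> mD; rewrite -[X in measurable X]setTI; exact: mX.
pose m1 : {measure set Omega -> \bar R} := mrestr P (mXB j B mB).
pose m2 : {measure set Omega -> \bar R} := mscale (NngNum (fine_ge0 (measure_ge0 mu B))) P.
have m2E D : m2 D = (P D * mu B)%E.
  rewrite muleC -[in RHS](fineK (fin_num_measure mu B mB)).
  by [].
rewrite -m2E -[LHS]/(m1 C).
have TC : forall i : nat, cylinders ((fun _ : nat => [set: Omega]) i).
  by move=> _; exact: cylinders_setT.
have := @g_sigma_algebra_measure_unique _ R Omega cylinders cylinders_measurable (fun=> setT) TC.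
apply => //.
- by rewrite bigcup_const//; exists 0%N.
- exact: cylinders_setI.
- move=> _ [A [mA ->]]; rewrite m2E -[LHS]/(P (_ `&` X j @^-1` B)).
  (* One family of sets indexed by [j |: J] describes the cylinder together with the event on [X j];
     overwriting [A j] does not alter the cylinder since [j] is outside [J]. *)
  pose A' i := if i == j then B else A i.
  have mA' i : measurable (A' i) by rewrite /A'; case: ifP.
  have A'J i : i \in J -> A' i = A i.
    by move=> iJ; rewrite /A'; case: eqP => // ij; rewrite -ij iJ in jJ.
  have := X_indep (j |: J)%SET A' mA'.
  rewrite big_setU1//= {2}/A' eqxx X_law// muleC => h.
  rewrite (_ : \bigcap_(i in [set` J]) _ `&` _ =
      \bigcap_(i in [set` (j |: J)%SET]) (X i @^-1` A' i)).
    rewrite h X_indep//; congr (_ * _)%E; apply: eq_bigr => i iJ.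
    by rewrite A'J.
  apply/seteqP; split=> w.
    move=> [Aw Bw] i /=; rewrite in_setU1 => /orP[/eqP->|iJ].
      by rewrite /A' eqxx.
    by rewrite A'J//; exact: Aw.
  move=> h'; split=> [i /= iJ|].
    by rewrite -A'J//; apply: h'; rewrite /= in_setU1 iJ orbT.
  by have := h' j; rewrite /= in_setU1 eqxx/= /A' eqxx; exact.
- move=> _; rewrite -[X in (X < _)%E]/(P (_ `&` X j @^-1` B)) setTI.
  by rewrite (le_lt_trans (probability_le1 P _)) ?ltry//; exact (mXB j B mB).
Qed.

End iid_prefix.

(** * Moments of sums of centred i.i.d. vectors *)

Section moments.
Context {dO dT : measure_display} {Omega : measurableType dO}
  {T : measurableType dT} {R : realType} {E : hilbertType R}.
Variables (P : probability Omega R) (mu : probability T R) (n : nat).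
Variable X : 'I_n -> Omega -> T.
Hypothesis X_iid : iid P X mu.
Variable Z : T -> E.
Hypothesis mZ : smeas Z.
Let q x := hdot E (Z x) (Z x).
Hypothesis iq2 : mu.-integrable setT (EFin \o (fun x => q x ^+ 2)).
Hypothesis Z_mean0 : forall v, \int[mu]_x hdot E v (Z x) = 0.

Let tau := \int[mu]_x q x.
Let kappa := \int[mu]_x (q x ^+ 2).
Let S (s : seq 'I_n) w := \sum_(i <- s) Z (X i w).

Let mX i : measurable_fun setT (X i). Proof. by have [h _ _] := X_iid. Qed.

Let iq : mu.-integrable setT (EFin \o q).
Proof.
apply: (@integrable_le _ _ _ _ _ measurableT _ (fun x => 1 + q x ^+ 2)) => //.
- exact: smeas_dot.
- by apply: integrableD_EFin => //; exact/finite_valued_integrable/finite_valued_cst.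
- move=> x _; rewrite ger0_norm ?dot_ge0//.
  by have := sqr_ge0 (q x - 1); have := dot_ge0 (Z x); rewrite /q; lra.
Qed.

Let iZ : mu.-integrable setT (EFin \o (fun x => hnorm (Z x))).
Proof. exact: sqr_integrable_hnorm. Qed.

Lemma iid_integrable (f : T -> R) i : mu.-integrable setT (EFin \o f) ->
  P.-integrable setT (EFin \o (fun w => f (X i w))).
Proof.
move=> /integrableP[mf fi]; apply/integrableP; split.
  exact: (measurableT_comp mf (mX i)).
apply: le_lt_trans fi.
have -> : (\int[mu]_x `|(EFin \o f) x| = \int[pushforward P (X i)]_x `|(EFin \o f) x|)%E.
  apply: eq_measure_integral => A mA _; have [_ X_law _] := X_iid.
  exact/esym/X_law.
rewrite (ge0_integral_pushforward (mX i))//.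
exact: measurableT_comp.
Qed.

Lemma iid_Rintegral (f : T -> R) i : mu.-integrable setT (EFin \o f) ->
  \int[P]_w f (X i w) = \int[mu]_x f x.
Proof.
move=> fi; rewrite /Rintegral; congr fine.
have -> : (\int[mu]_x (f x)%:E = \int[pushforward P (X i)]_x (f x)%:E)%E.
  apply: eq_measure_integral => A mA _; have [_ X_law _] := X_iid.
  exact/esym/X_law.
rewrite (integral_pushforward (mX i))//; first exact: measurable_int fi.
exact: iid_integrable.
Qed.

Lemma sum_dot_integrable s (v : E) : P.-integrable setT (EFin \o (fun w => hdot E (S s w) v)).
Proof.
rewrite (_ : EFin \o _ = fun w => (\sum_(i <- s) (hdot E v (Z (X i w)))%:E)%E); last first.
  apply/funext => w; rewrite /= dot_suml sumEFin.
  by congr (_%:E); apply: eq_bigr => i _; rewrite dotC.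
apply: integrable_sum => // i _; apply: (@iid_integrable (fun x => hdot E v (Z x))).
exact: smeas_dot_integrable.
Qed.

Lemma sum_dot_mean0 s (v : E) : \int[P]_w hdot E (S s w) v = 0.
Proof.
rewrite /Rintegral (_ : integral _ _ _ = (\int[P]_w \sum_(i <- s) (hdot E v (Z (X i w)))%:E)%E).
  rewrite integral_sum//; last first.
    move=> i; apply: (@iid_integrable (fun x => hdot E v (Z x))).
    exact: smeas_dot_integrable.
  rewrite big1 => // i _; apply/eqP; rewrite -fine_eq0; last first.
    apply: integrable_fin_num => //; apply: (@iid_integrable (fun x => hdot E v (Z x))).
    exact: smeas_dot_integrable.
  apply/eqP; apply: etrans (Z_mean0 v).
  apply: (@iid_Rintegral (fun x => hdot E v (Z x))).
  exact: smeas_dot_integrable.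
apply: eq_integral => w _; rewrite dot_suml sumEFin.
by congr (_%:E); apply: eq_bigr => i _; rewrite dotC.
Qed.

(** The partial sum is measurable for the sigma-algebra generated by the [X i] with [i] in [s], of
    which [X j] is independent, so [X j] can be integrated out with the sum held fixed. The exponent
    [k] is 1 for the second moment and 2 for the fourth. *)
Lemma sum_step_tonelli s j k : j \notin s ->
  let G w := (\int[mu]_x (hdot E (S s w + Z x) (S s w + Z x) ^+ k)%:E)%E in
  measurable_fun setT G /\
  (\int[P]_w (hdot E (S (j :: s) w) (S (j :: s) w) ^+ k)%:E = \int[P]_w G w)%E.
Proof.
move=> js; pose J := [set i in s]%SET.
pose f (z : prefix_space X J * T) :=
  (hdot E (S s z.1 + Z z.2) (S s z.1 + Z z.2) ^+ k)%:E.
have f0 z : (0 <= f z)%E by rewrite lee_fin exprn_ge0// dot_ge0.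
have mf : measurable_fun setT f.
  have mW : smeas (fun z : prefix_space X J * T => S s z.1 + Z z.2).
    apply: smeasD; last exact: smeas_precomp measurable_snd mZ.
    apply: (smeas_precomp (Z := fun w : prefix_space X J => S s w) measurable_fst).
    rewrite /S; under eq_fun do rewrite big_seq.
    apply: smeas_sum => i si; apply: smeas_precomp mZ.
    by apply: measurable_prefix; rewrite inE.
  by apply/measurable_EFinP/measurable_funX/smeas_dot.
have mid := measurable_to_prefix (J := J) X_iid.
split; first exact: (measurable_indep_section mu mid mf f0).
have := @indep_tonelli _ _ _ _ _ _ _ P mu _ _ mid (mX j) _ _ mf f0.
rewrite /f/= => <-//.
  by apply: eq_integral => w _; rewrite /S big_cons addrC.
move=> C B mC mB; rewrite preimage_id; apply: (iid_prefix_indep X_iid (J := J)) => //.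
by rewrite inE.
Qed.

Let smeas_cubic : smeas (fun x => q x *: Z x).
Proof. by apply: (smeas_scale (c := fun z => hdot E z z)) => // u l ul; exact: hcvg_dot. Qed.

Let hnorm_cubic_integrable : mu.-integrable setT (EFin \o (fun x => hnorm (q x *: Z x))).
Proof.
apply: (@integrable_le _ _ _ _ _ measurableT _ (fun x => q x + q x ^+ 2)) => //.
- exact: smeas_hnorm.
- exact: integrableD_EFin.
- move=> x _; rewrite ger0_norm ?hnorm_ge0// hnormZ ger0_norm ?dot_ge0//.
  rewrite (_ : q x + q x ^+ 2 = q x * (1 + q x)); last by ring.
  rewrite ler_wpM2l ?dot_ge0// /q -sqr_hnorm.
  by have := sqr_ge0 (hnorm (Z x) - 1); have := hnorm_ge0 (Z x); lra.
Qed.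

(** [V] is the Bochner mean of |Z|^2 Z. Its value is immaterial: it will only be paired with centred
    sums. *)
Let cubic_mean : exists V, forall u, \int[mu]_x hdot E u (q x *: Z x) = hdot E u V.
Proof.
have [V VP] := bochner_integral_exists measurableT smeas_cubic hnorm_cubic_integrable.
by exists V => u; exact: bochner_integral_dot VP.
Qed.

Lemma shift_second_moment u :
  (\int[mu]_x (hdot E (u + Z x) (u + Z x) ^+ 1)%:E = (hdot E u u + tau)%:E)%E.
Proof.
have ih : mu.-integrable setT (EFin \o (fun x => 2 * hdot E u (Z x))).
  by apply: integrableZ_EFin => //; exact: smeas_dot_integrable.
have ic : mu.-integrable setT (EFin \o (fun=> hdot E u u)).
  exact/finite_valued_integrable/finite_valued_cst.
transitivity (\int[mu]_x ((hdot E u u + 2 * hdot E u (Z x)) + q x)%:E)%E.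
  apply: eq_integral => x _; rewrite expr1 dotDl !dotDr (dotC (Z x) u) /q.
  by congr (_%:E); ring.
have i2 := integrableD_EFin measurableT ic ih.
have i3 := integrableD_EFin measurableT i2 iq.
rewrite -[LHS]fineK; last exact (integrable_fin_num measurableT i3).
congr (_%:E); rewrite -/(Rintegral _ _ _) RintegralD// RintegralD// RintegralZl//.
  by rewrite Z_mean0 mulr0 addr0 Rintegral_cst_probability.
exact: smeas_dot_integrable.
Qed.

(** With U = |u|^2, h = <u, Z> and q = |Z|^2, the integrand is U^2 + q^2 + 4 h^2 + 2 U q + 4 U h + 4
    q h. Cauchy-Schwarz merges the third and fourth terms into 6 U q, and 4 U h has mean 0. [V] is
    chosen before [u], so it remains constant when [u] becomes the random partial sum. *)
Lemma shift_fourth_moment_le : exists V, forall u,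
  (\int[mu]_x (hdot E (u + Z x) (u + Z x) ^+ 2)%:E <=
   (hdot E u u ^+ 2 + 6 * hdot E u u * tau + kappa + 4 * hdot E u V)%:E)%E.
Proof.
have [V VP] := cubic_mean; exists V => u; set U := hdot E u u.
have ic : mu.-integrable setT (EFin \o (fun=> U ^+ 2)).
  exact/finite_valued_integrable/finite_valued_cst.
have ih : mu.-integrable setT (EFin \o (fun x => hdot E u (Z x))).
  exact: smeas_dot_integrable.
have iu : mu.-integrable setT (EFin \o (fun x => hdot E u (q x *: Z x))).
  exact: smeas_dot_integrable.
have i1 := integrableZ_EFin measurableT (6 * U) iq.
have i2 := integrableZ_EFin measurableT (4 * U) ih.
have i3 := integrableZ_EFin measurableT 4 iu.
have s1 := integrableD_EFin measurableT ic i1.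
have s2 := integrableD_EFin measurableT s1 iq2.
have s3 := integrableD_EFin measurableT s2 i3.
have s4 := integrableD_EFin measurableT s3 i2.
rewrite (_ : (_ + 4 * hdot E u V)%:E = (\int[mu]_x (U ^+ 2 + 6 * U * q x + q x ^+ 2 +
    4 * hdot E u (q x *: Z x) + 4 * U * hdot E u (Z x))%:E)%E); last first.
  rewrite -[RHS]fineK; last exact (integrable_fin_num measurableT s4).
  congr (_%:E); rewrite -/(Rintegral _ _ _) !RintegralD//.
  rewrite (RintegralZl (6 * U) measurableT iq) (RintegralZl 4 measurableT iu).
  rewrite (RintegralZl (4 * U) measurableT ih).
  by rewrite Z_mean0 mulr0 addr0 VP Rintegral_cst_probability.
apply: ge0_le_integral => //.
- by move=> x _; rewrite lee_fin sqr_ge0.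
- by apply/measurable_EFinP/measurable_funX/smeas_dot; apply: smeasD => //; exact: smeas_cst.
- exact: measurable_int s4.
- move=> x _; rewrite lee_fin dotDl !dotDr (dotC (Z x) u) dotZr -/U -/(q x).
  have : hdot E u (Z x) ^+ 2 <= U * q x.
    rewrite -[leLHS]real_normK ?num_real// /U /q -!sqr_hnorm -exprMn.
    by rewrite ler_pXn2r ?nnegrE ?mulr_ge0 ?hnorm_ge0// cauchy_schwarz_dot.
  clearbody U; move: (hdot E u (Z x)) (q x) => h y; lra.
Qed.

(** Integrability is part of the induction, since each step integrates the previous sum. A new
    summand after m of them adds kappa + 6 m tau^2, the term in [V] having mean 0, and 3 m (m - 1) +
    6 m = 3 (m + 1) m. *)
Lemma iid_sum_moments s : uniq s ->
  [/\ P.-integrable setT (EFin \o (fun w => hdot E (S s w) (S s w))),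
      \int[P]_w hdot E (S s w) (S s w) = (size s)%:R * tau,
      P.-integrable setT (EFin \o (fun w => hdot E (S s w) (S s w) ^+ 2)) &
      \int[P]_w (hdot E (S s w) (S s w) ^+ 2) <=
        (size s)%:R * kappa + 3 * (size s)%:R * ((size s)%:R - 1) * tau ^+ 2].
Proof.
elim: s => [_|j s IH /= /andP[js us]].
  have S0 w : hdot E (S [::] w) (S [::] w) = 0 by rewrite /S big_nil dot0l.
  have i0 : P.-integrable setT (EFin \o (fun=> 0)).
    exact/finite_valued_integrable/finite_valued_cst.
  split.
  - by rewrite (_ : _ \o _ = EFin \o (fun=> 0))//; apply/funext => w /=; rewrite S0.
  - rewrite mul0r; under eq_Rintegral do rewrite S0.
    by rewrite Rintegral_cst_probability.
  - rewrite (_ : _ \o _ = EFin \o (fun=> 0))//; apply/funext => w /=.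
    by rewrite S0 expr0n.
  - under eq_Rintegral do rewrite S0 expr0n.
    by rewrite Rintegral_cst_probability !mul0r mulr0 !mul0r addr0.
have [i1 e1 i2 e2] := IH us.
have mS : smeas (fun w => S (j :: s) w).
  by apply: smeas_sum => i _; apply: smeas_precomp mZ.
have ic c : P.-integrable setT (EFin \o (fun=> c)).
  exact/finite_valued_integrable/finite_valued_cst.
have [_ t1] := sum_step_tonelli 1 js.
have [mG t2] := sum_step_tonelli 2 js.
have it := integrableD_EFin measurableT i1 (ic tau).
have {}t1 : (\int[P]_w (hdot E (S (j :: s) w) (S (j :: s) w))%:E =
    \int[P]_w (hdot E (S s w) (S s w) + tau)%:E)%E.
  rewrite (eq_integral (fun w => (hdot E (S (j :: s) w) (S (j :: s) w) ^+ 1)%:E))//.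
  by rewrite t1; apply: eq_integral => w _; rewrite shift_second_moment.
have [V VP] := shift_fourth_moment_le.
pose Bd w := hdot E (S s w) (S s w) ^+ 2 + 6 * tau * hdot E (S s w) (S s w) + kappa +
  4 * hdot E (S s w) V.
have iV := integrableZ_EFin measurableT 4 (sum_dot_integrable s V).
have i6 := integrableZ_EFin measurableT (6 * tau) i1.
have b1 := integrableD_EFin measurableT i2 i6.
have b2 := integrableD_EFin measurableT b1 (ic kappa).
have iB : P.-integrable setT (EFin \o Bd) := integrableD_EFin measurableT b2 iV.
have {}t2 : (\int[P]_w (hdot E (S (j :: s) w) (S (j :: s) w) ^+ 2)%:E <=
    \int[P]_w (Bd w)%:E)%E.
  rewrite t2; apply: ge0_le_integral => //.
  - by move=> w _; apply: integral_ge0 => x _; rewrite lee_fin sqr_ge0.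
  - exact: measurable_int iB.
  - move=> w _; apply: le_trans (VP _) _; rewrite lee_fin /Bd.
    by rewrite le_eqVlt; apply/orP; left; apply/eqP; ring.
have int1 : P.-integrable setT (EFin \o (fun w => hdot E (S (j :: s) w) (S (j :: s) w))).
  apply/integrableP; split; first exact/measurable_EFinP/smeas_dot.
  rewrite (eq_integral (fun w => (hdot E (S (j :: s) w) (S (j :: s) w))%:E)); last first.
    by move=> w _; rewrite /= ger0_norm// dot_ge0.
  by rewrite t1; have := integrable_fin_num measurableT it; rewrite fin_numElt => /andP[].
have int2 : P.-integrable setT (EFin \o (fun w => hdot E (S (j :: s) w) (S (j :: s) w) ^+ 2)).
  apply/integrableP; split; first exact/measurable_EFinP/measurable_funX/smeas_dot.
  rewrite (eq_integral (fun w => (hdot E (S (j :: s) w) (S (j :: s) w) ^+ 2)%:E)); last first.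
    by move=> w _; rewrite /= ger0_norm// sqr_ge0.
  apply: le_lt_trans t2 _.
  by have := integrable_fin_num measurableT iB; rewrite fin_numElt => /andP[].
split=> //.
- transitivity (\int[P]_w (hdot E (S s w) (S s w) + tau)); first by rewrite /Rintegral t1.
  rewrite RintegralD// e1 Rintegral_cst_probability.
  by rewrite -natr1 mulrDl mul1r.
- apply: (@le_trans _ _ (\int[P]_w Bd w)).
    apply: fine_le t2; exact: integrable_fin_num.
  rewrite /Bd RintegralD// RintegralD// RintegralD// !RintegralZl//.
    rewrite sum_dot_mean0 e1 Rintegral_cst_probability -[(size s).+1%:R]natr1; move: e2.
    move: (\int[P]_w (hdot E (S s w) (S s w) ^+ 2)) (size s)%:R tau kappa => A m t k.
    lra.
  exact: sum_dot_integrable.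
Qed.

(* With y the norm of the sum and a = sqrt (n tau) = sqrt (E y^2): AM-GM gives
   y <= (y^2 / a + a) / 2, and y >= 3 y^2 / (4 a) - y^4 / (16 a^3) because the
   difference is y (y - 2 a)^2 (y + 4 a) / (16 a^3); moreover E y^4 <= 4 a^4. *)
Lemma iid_mean_hnorm_bounds : (0 < n)%N -> 0 < tau -> kappa <= n%:R * tau ^+ 2 ->
  let M := (\int[P]_w (hnorm (n%:R^-1 *: \sum_(i < n) Z (X i w)))%:E)%E in
  ((1 / 2 * Num.sqrt (tau / n%:R))%:E <= M)%E /\
  (M <= (Num.sqrt (tau / n%:R))%:E)%E.
Proof.
move=> n0 tau0 kappa_le M; rewrite {}/M; set s := enum 'I_n.
have [i2 e2 i4 e4] := iid_sum_moments (enum_uniq 'I_n).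
rewrite size_enum_ord in e2 e4.
have nR : 0 < n%:R :> R by rewrite ltr0n.
pose y w := hnorm (S s w).
have y2 w : hdot E (S s w) (S s w) = y w ^+ 2 by rewrite sqr_hnorm.
pose a := Num.sqrt (n%:R * tau).
have a0 : 0 < a by rewrite sqrtr_gt0 mulr_gt0.
have a2 : a ^+ 2 = n%:R * tau by rewrite sqr_sqrtr// mulr_ge0 ?ltW.
have iy : P.-integrable setT (EFin \o y).
  by apply: sqr_integrable_hnorm i2 => //; apply: smeas_sum => i _; apply: smeas_precomp mZ.
have -> : (\int[P]_w (hnorm (n%:R^-1 *: \sum_(i < n) Z (X i w)))%:E =
    (n%:R^-1 * \int[P]_w y w)%:E)%E.
  rewrite -RintegralZl// /Rintegral fineK; last first.
    exact (integrable_fin_num measurableT (integrableZ_EFin measurableT n%:R^-1 iy)).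
  apply: eq_integral => w _; rewrite hnormZ ger0_norm ?invr_ge0 ?ltW//.
  by rewrite /y /S big_enum.
have -> : Num.sqrt (tau / n%:R) = n%:R^-1 * a.
  rewrite (_ : tau / n%:R = n%:R^-1 ^+ 2 * (n%:R * tau)); last by field; rewrite gt_eqF.
  by rewrite sqrtrM ?sqr_ge0// sqrtr_sqr ger0_norm ?invr_ge0 ?ltW.
have ic c : P.-integrable setT (EFin \o (fun=> c)).
  exact/finite_valued_integrable/finite_valued_cst.
rewrite !lee_fin mulrCA !ler_pM2l ?invr_gt0//; split; last first.
  have iu := integrableD_EFin measurableT
    (integrableZ_EFin measurableT (2 * a)^-1 i2) (ic (a / 2)).
  have y_le w : y w <= (2 * a)^-1 * hdot E (S s w) (S s w) + a / 2.
    rewrite y2 -subr_ge0.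
    rewrite [X in 0 <= X](_ : _ = (2 * a)^-1 * (y w - a) ^+ 2); last first.
      by field; rewrite gt_eqF.
    by rewrite mulr_ge0 ?sqr_ge0// invr_ge0 mulr_ge0 ?ltW.
  apply: le_trans (le_Rintegral measurableT iy iu (fun w _ => y_le w)) _.
  rewrite RintegralD ?RintegralZl ?Rintegral_cst_probability//; last first.
    exact: integrableZ_EFin.
  rewrite e2 -a2 le_eqVlt; apply/orP; left; apply/eqP.
  by field; rewrite gt_eqF.
have iu := integrableB_EFin measurableT
  (integrableZ_EFin measurableT (3 / (4 * a)) i2)
  (integrableZ_EFin measurableT (16 * a ^+ 3)^-1 i4).
have y_ge w : 3 / (4 * a) * hdot E (S s w) (S s w) -
    (16 * a ^+ 3)^-1 * hdot E (S s w) (S s w) ^+ 2 <= y w.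
  rewrite y2 -subr_ge0.
  rewrite [X in 0 <= X](_ : _ =
    (16 * a ^+ 3)^-1 * (y w * (y w - 2 * a) ^+ 2 * (y w + 4 * a))); last first.
    by field; rewrite gt_eqF.
  have yw0 : 0 <= y w by exact: hnorm_ge0.
  have a3 : 0 <= (16 * a ^+ 3)^-1 by rewrite invr_ge0 mulr_ge0// exprn_ge0// ltW.
  have ya : 0 <= y w + 4 * a by rewrite addr_ge0// mulr_ge0// ltW.
  by rewrite mulr_ge0// mulr_ge0// mulr_ge0// sqr_ge0.
apply: le_trans (le_Rintegral measurableT iu iy (fun w _ => y_ge w)).
rewrite RintegralB; [|by []|exact: integrableZ_EFin|exact: integrableZ_EFin].
rewrite !RintegralZl// e2 -a2.
have m4 : \int[P]_w hdot E (S s w) (S s w) ^+ 2 <= 4 * a ^+ 4.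
  rewrite (_ : a ^+ 4 = (n%:R * tau) ^+ 2); last by rewrite -a2 -exprM.
  apply: le_trans e4 _; rewrite exprMn.
  (* The largeness of n enters here: n kappa is at most (n tau)^2, which adds to 3 n (n - 1) tau^2
     <= 3 (n tau)^2. *)
  have := ler_wpM2l (ltW nR) kappa_le.
  have : 0 <= n%:R * tau ^+ 2 by rewrite mulr_ge0 ?sqr_ge0 ?ltW.
  by move: kappa tau (n%:R : R) => k t m; lra.
(* The middle value is 3 a / 4 - a / 4 = a / 2. *)
apply: (@le_trans _ _ (3 / (4 * a) * a ^+ 2 - (16 * a ^+ 3)^-1 * (4 * a ^+ 4))).
  rewrite le_eqVlt; apply/orP; left; apply/eqP.
  by field; rewrite gt_eqF.
by rewrite lerD2l lerN2 ler_wpM2l// invr_ge0 mulr_ge0 ?exprn_ge0 ?ltW.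
Qed.

End moments.

(** * Reproducing kernels and their derivatives *)

Lemma within_open_cvg (T U : topologicalType) (A : set T) (f : T -> U) (x : T) :
  open A -> A x -> {within A, continuous f} -> f y @[y --> x] --> f x.
Proof.
move=> oA Ax /subspace_continuousP/(_ x Ax).
by rewrite within_interior//; have -> : interior A = A by exact/interior_id.
Qed.

Lemma open_setX (T U : topologicalType) (A : set T) (B : set U) :
  open A -> open B -> open (A `*` B).
Proof.
move=> oA oB; rewrite (_ : A `*` B = fst @^-1` A `&` snd @^-1` B)//.
apply: openI; apply: open_comp => // z _; [exact: cvg_fst|exact: cvg_snd].
Qed.

(** * Derivatives along a line and joint continuity *)

Section directional.
Context {R : realType} {V : normedModType R}.
Implicit Types (f : V -> R) (x v : V).

Lemma is_derive_line f x v (t : R) : derivable f (x + t *: v) v ->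
  is_derive t 1 (fun s : R => f (x + s *: v)) ('D_v f (x + t *: v)).
Proof.
move=> df.
have E : (fun h : R => h^-1 *: (((fun s : R => f (x + s *: v)) \o shift t) (h *: (1 : R)) -
    f (x + t *: v))) =
  (fun h : R => h^-1 *: ((f \o shift (x + t *: v)) (h *: v) - f (x + t *: v))).
  apply/funext => h /=; congr (_ *: (f _ - _)).
  by rewrite [h *: 1]mulr1 scalerDl addrCA.
by apply: DeriveDef; rewrite /derivable /derive E.
Qed.

Lemma directional_MVT f x v (h : R) : 0 < h ->
  (forall t, 0 <= t <= h -> derivable f (x + t *: v) v) ->
  exists2 c, 0 < c < h & f (x + h *: v) - f x = h * 'D_v f (x + c *: v).
Proof.
move=> h0 df.
have [||c] := @MVT R (fun s => f (x + s *: v)) (fun s => 'D_v f (x + s *: v)) 0 h h0.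
- move=> t; rewrite in_itv/= => /andP[/ltW t0 /ltW th].
  by apply: is_derive_line; apply: df; rewrite t0.
- apply: derivable_within_continuous => t; rewrite in_itv/= => th.
  by have [] := is_derive_line (df _ th).
- by rewrite in_itv/= scale0r addr0 subr0 mulrC => ch cE; exists c.
Qed.

Lemma derivable_quotient_cvg f x v : derivable f x v ->
  n.+1%:R * (f (x + n.+1%:R^-1 *: v) - f x) @[n --> \oo] --> 'D_v f x.
Proof.
move=> df.
have h1 : h^-1 *: ((f \o shift x) (h *: v) - f x) @[h --> (0 : R)^'] --> 'D_v f x by exact: df.
rewrite (_ : (fun n => _) = fun n =>
    (n.+1%:R^-1)^-1 *: ((f \o shift x) (n.+1%:R^-1 *: v) - f x)); last first.
  by apply/funext => n; rewrite /= invrK [x + _]addrC.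
apply: (cvgr_dnbhsP _ _ _).1 h1 _ _; split; last exact: cvg_harmonic.
by move=> n; rewrite invr_eq0 pnatr_eq0.
Qed.

End directional.

Section joint_continuity.
Context {R : realType} {d : nat} {X : set 'rV[R]_d}.
Hypothesis X_open : open X.
Implicit Types (x y : 'rV[R]_d) (g : 'rV[R]_d -> 'rV[R]_d -> R).

Lemma jointly_continuous_cvg g x y : jointly_continuous X g -> X x -> X y ->
  g z.1 z.2 @[z --> (x, y)] --> g x y.
Proof.
move=> gc Xx Xy.
exact: (@within_open_cvg _ _ (X `*` X) (fun z => g z.1 z.2) (x, y) (open_setX X_open X_open)
  (conj Xx Xy) gc).
Qed.

Lemma jointly_continuous_line g x y v e : jointly_continuous X g -> X x -> X y ->
  0 < e -> exists2 r, 0 < r & forall s t, `|s| < r -> `|t| < r ->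
    [/\ X (x + s *: v), X (y + t *: v) & `|g (x + s *: v) (y + t *: v) - g x y| < e].
Proof.
move=> gc Xx Xy e0.
have : nbhs (x, y) [set z | [/\ X z.1, X z.2 & `|g z.1 z.2 - g x y| < e]].
  have h1 : nbhs (x, y) (X `*` X).
    by apply: open_nbhs_nbhs; split=> //; exact: open_setX.
  have h2 : \forall z \near (x, y), `|g x y - g z.1 z.2| < e.
    have /cvgrPdist_lt := jointly_continuous_cvg gc Xx Xy; exact.
  apply: filterS2 h1 h2 => z [? ?] ?; split=> //.
  by rewrite distrC.
move=> /nbhs_ballP[r /= r0 rP].
(* The added 1 keeps the denominator positive when [v] is 0. *)
have v0 : 0 < `|v| + 1 by rewrite ltr_wpDl.
have in_ball w s : `|s| < r / (`|v| + 1) -> ball w r (w + s *: v).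
  rewrite ltr_pdivlMr// => sr; rewrite -ball_normE /= opprD addrA subrr sub0r normrN.
  rewrite normrZ; apply: le_lt_trans sr.
  by rewrite ler_wpM2l// lerDl.
exists (r / (`|v| + 1)); first by rewrite divr_gt0.
by move=> s t sr tr; apply: (rP (x + s *: v, y + t *: v)); split; exact: in_ball.
Qed.

End joint_continuity.

(** * Difference quotients of kernel sections in the RKHS *)

Section kernel_derivatives.
Context {R : realType} {d : nat} {X : set 'rV[R]_d} {k : 'rV[R]_d -> 'rV[R]_d -> R}.
Variable H : rkhs X k.
Hypothesis X_open : open X.
Hypothesis k_C11 : C11 X k.
Local Notation e_ i := (delta_mx 0 i : 'rV[R]_d).
Implicit Types x y : 'rV[R]_d.

(** Values on [X] determine an element of the RKHS, so any element with the right values is the one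
    that [xget] picks. *)
Lemma rkhs_elt_spec (g : 'rV[R]_d -> R) (h : H) :
  (forall y, X y -> rkhs_eval h y = g y) -> rkhs_elt H g = h.
Proof.
move=> hg; apply: (@rkhs_eval_inj _ _ _ _ H) => y Xy; rewrite hg//.
have : [set h : H | forall y, X y -> rkhs_eval h y = g y] (rkhs_elt H g).
  by apply: xgetPex; exists h.
exact.
Qed.

Lemma rkhs_eltP x : X x ->
  (forall y, X y -> rkhs_eval (rkhs_elt H (k x)) y = k x y) /\
  (forall f, hdot H f (rkhs_elt H (k x)) = rkhs_eval f x).
Proof.
move=> Xx; have [kx kxE kxR] := rkhs_reproducing H Xx.
by rewrite (rkhs_elt_spec kxE).
Qed.

Lemma dot_rkhs_elt x y : X x -> X y ->
  hdot H (rkhs_elt H (k x)) (rkhs_elt H (k y)) = k x y.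
Proof. by move=> Xx Xy; rewrite (rkhs_eltP Xy).2 (rkhs_eltP Xx).1. Qed.

Let quotient (i : 'I_d) (x : 'rV[R]_d) (h : R) : H :=
  h^-1 *: (rkhs_elt H (k (x + h *: e_ i)) - rkhs_elt H (k x)).

(** By the reproducing property the inner product is the mixed second difference of [k] divided by h
    h'; the mean value theorem, in the first argument and then in the second, turns it into a mixed
    derivative. *)
Lemma dot_quotient i x y h h' : 0 < h -> 0 < h' ->
  (forall t, 0 <= t <= h -> X (x + t *: e_ i)) ->
  (forall t, 0 <= t <= h' -> X (y + t *: e_ i)) ->
  exists c c', [/\ 0 < c < h, 0 < c' < h' &
    hdot H (quotient i x h) (quotient i y h') =
    partial2 (partial1 k i) i (x + c *: e_ i) (y + c' *: e_ i)].
Proof.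
move=> h0 h'0 Xx Xy; have [_ k1 _ k12] := k_C11.
have Xx0 : X x by have := Xx 0; rewrite scale0r addr0 lexx ltW//; exact.
have Xy0 : X y by have := Xy 0; rewrite scale0r addr0 lexx ltW//; exact.
have Xxh : X (x + h *: e_ i) by apply: Xx; rewrite lexx ltW.
have Xyh : X (y + h' *: e_ i) by apply: Xy; rewrite lexx ltW.
have dk z w : X z -> X w -> derivable (fun z => k z w) z (e_ i).
  by move=> Xz Xw; exact: (k1 i).1.
(* Applied to the difference in the second argument, so that a single [c] serves both of its
   values. *)
have [|c ch cE] := @directional_MVT _ _
    (fun z => k z (y + h' *: e_ i) - k z y) x (e_ i) h h0.
  by move=> t th; apply: derivableB; apply: dk => //; exact: Xx.
have Xc : X (x + c *: e_ i).
  by apply: Xx; move: ch => /andP[/ltW-> /ltW->].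
have [|c' ch' cE'] := @directional_MVT _ _ (partial1 k i (x + c *: e_ i)) y (e_ i) h' h'0.
  by move=> t th; apply: (k12 i i).1 => //; exact: Xy.
exists c, c'; split=> //.
have cE1 : 'D_(e_ i) (fun z => k z (y + h' *: e_ i) - k z y) (x + c *: e_ i) =
    partial1 k i (x + c *: e_ i) (y + h' *: e_ i) - partial1 k i (x + c *: e_ i) y.
  by rewrite deriveB//; apply: dk.
set K := partial2 _ _ _ _.
have {}cE : k (x + h *: e_ i) (y + h' *: e_ i) - k (x + h *: e_ i) y -
    (k x (y + h' *: e_ i) - k x y) = h * (h' * K) by rewrite cE cE1 cE'.
rewrite dotZl dotZr dotBl !dotBr !dot_rkhs_elt//.
rewrite (_ : K = h^-1 * (h'^-1 * (h * (h' * K)))); last first.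
  by rewrite (mulrCA h'^-1) !mulKf ?gt_eqF.
by rewrite -cE; congr (_ * (_ * _)); ring.
Qed.

(** [m] and [n] vary independently: for [x = y] this yields the Cauchy property, and for general
    [x], [y] the inner product of the limits. *)
Lemma dot_quotient_near i x y e : X x -> X y -> 0 < e -> exists N, forall m n,
  (N <= m)%N -> (N <= n)%N ->
  `|hdot H (quotient i x m.+1%:R^-1) (quotient i y n.+1%:R^-1) -
    partial2 (partial1 k i) i x y| < e.
Proof.
move=> Xx Xy e0; have [_ _ _ k12] := k_C11.
have [r r0 rP] := jointly_continuous_line X_open (e_ i) (k12 i i).2 Xx Xy e0.
have [N Nr] : exists N, N.+1%:R^-1 < r.
  have /cvgrPdist_lt/(_ r r0)[N _ hN] := @cvg_harmonic R.
  by exists N; have := hN N (leqnn N); rewrite /= sub0r normrN ger0_norm// invr_ge0.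
have hr p t : (N <= p)%N -> 0 <= t <= p.+1%:R^-1 -> `|t| < r.
  move=> Np /andP[t0 tp]; rewrite ger0_norm//; apply: le_lt_trans Nr.
  by apply: le_trans tp _; rewrite lef_pV2 ?posrE// ler_nat.
exists N => m n Nm Nn.
have [||||c [c' [cm cn ->]]] := @dot_quotient i x y m.+1%:R^-1 n.+1%:R^-1.
- by rewrite invr_gt0.
- by rewrite invr_gt0.
- by move=> t /(hr _ _ Nm) tr; have [] := rP t t tr tr.
- by move=> t /(hr _ _ Nn) tr; have [] := rP t t tr tr.
have [] := rP c c' => //.
- by apply: (hr _ _ Nm); move: cm => /andP[/ltW-> /ltW->].
- by apply: (hr _ _ Nn); move: cn => /andP[/ltW-> /ltW->].
Qed.

(** |Q_m - Q_n|^2 expands into four inner products, each within e^2 / 4 of the same mixed derivative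
    at (x, x). Pairing the limit with the section at [y] gives the derivative of [k] in its first
    argument, so [partial1 k i x] does belong to the RKHS and [rkhs_elt] is not the junk value. *)
Lemma quotient_cvg i x : X x ->
  hcvg (fun n => quotient i x n.+1%:R^-1) (rkhs_elt H (partial1 k i x)).
Proof.
move=> Xx.
have [L LP] : exists L, hcvg (fun n => quotient i x n.+1%:R^-1) L.
  apply: hcvg_cauchy => e e0.
  have e40 : 0 < e ^+ 2 / 4 by rewrite divr_gt0 ?exprn_gt0.
  have [N NP] := dot_quotient_near i Xx Xx e40.
  exists N => m n Nm Nn; rewrite -(@ltr_pXn2r _ 2)// ?nnegrE ?hnorm_ge0 1?ltW//.
  rewrite sqr_hnorm dotBl !dotBr.
  have := NP m m Nm Nm; have := NP m n Nm Nn; have := NP n m Nn Nm; have := NP n n Nn Nn.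
  by rewrite !ltr_norml => /andP[? ?] /andP[? ?] /andP[? ?] /andP[? ?]; lra.
suff -> : rkhs_elt H (partial1 k i x) = L by [].
apply: rkhs_elt_spec => y Xy; rewrite -(rkhs_eltP Xy).2.
have h1 : hdot H (quotient i x n.+1%:R^-1) (rkhs_elt H (k y)) @[n --> \oo] -->
    hdot H L (rkhs_elt H (k y)) by exact: hcvg_dot LP (hcvg_cst _).
have [_ k1 _ _] := k_C11.
have h2 := derivable_quotient_cvg ((k1 i).1 x y Xx Xy).
apply: cvg_unique h1 _ => //; apply: cvg_trans h2; apply: near_eq_cvg.
have : nbhs x X by exact: open_nbhs_nbhs.
move=> /nbhs_ballP[r /= r0 rX].
have : N.+1%:R^-1 * (`|e_ i| + 1) @[N --> \oo] --> 0 * (`|e_ i| + 1).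
  by apply: cvgMl; exact: cvg_harmonic.
rewrite mul0r => /cvgrPdist_lt/(_ r r0)[N _ hN]; exists N => // n Nn /=.
have Xn : X (x + n.+1%:R^-1 *: e_ i).
  apply: rX; rewrite -ball_normE /= opprD addrA subrr sub0r normrN normrZ.
  have := hN n Nn; rewrite /= sub0r normrN; apply: le_lt_trans.
  by rewrite normrM ler_wpM2l// [leRHS]ger0_norm ?lerDl// addr_ge0.
by rewrite dotZl invrK dotBl !dot_rkhs_elt.
Qed.

Lemma dot_rkhs_partial i x y : X x -> X y ->
  hdot H (rkhs_elt H (partial1 k i x)) (rkhs_elt H (partial1 k i y)) =
  partial2 (partial1 k i) i x y.
Proof.
move=> Xx Xy; have h1 := hcvg_dot (quotient_cvg i Xx) (quotient_cvg i Xy).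
apply: cvg_unique h1 _ => //; apply/cvgrPdist_lt => e e0.
have [N NP] := dot_quotient_near i Xx Xy e0.
by exists N => // n Nn /=; rewrite distrC; exact: NP.
Qed.

End kernel_derivatives.

Lemma cvg_sqrt_polarization (R : realType) (T : Type) (F : set_system T) (a b : T -> R)
    (c : R) : Filter F -> a y @[y --> F] --> c -> b y @[y --> F] --> c ->
  Num.sqrt (a y - 2 * b y + c) @[y --> F] --> (0 : R).
Proof.
move=> FF ac bc; rewrite -[X in _ --> X](@sqrtr0 R).
have h : a y - 2 * b y + c @[y --> F] --> (0 : R).
  rewrite [X in _ --> X](_ : 0 = c - 2 * c + c); last by ring.
  apply: cvgD; last exact: cvg_cst.
  by apply: cvgB => //; exact: cvgMr.
exact: (cvg_comp _ _ h (@sqrt_continuous R 0)).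
Qed.

(** |F y - F x|^2 = G y y - 2 G y x + G x x, which tends to 0 by joint continuity. It serves for [k]
    and for its mixed derivatives. *)
Lemma kernel_map_continuous (R : realType) (d : nat) (X : set 'rV[R]_d) (E : hilbertType R)
    (F : 'rV[R]_d -> E) (G : 'rV[R]_d -> 'rV[R]_d -> R) (x : 'rV[R]_d) :
  open X -> jointly_continuous X G ->
  (forall x y, X x -> X y -> hdot E (F x) (F y) = G x y) -> X x ->
  hnorm (F y - F x) @[y --> x] --> (0 : R).
Proof.
move=> oX cG FG Xx.
have c1 : G y x @[y --> x] --> G x x.
  apply: (@cvg_comp _ _ _ (fun y => (y, x)) (fun z => G z.1 z.2) _ (nbhs (x, x)) _).
    exact: (@cvg_pair _ _ _ (nbhs x) (nbhs x) (nbhs x) _ _ _ id (fun=> x) cvg_id (cvg_cst x)).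
  exact: (jointly_continuous_cvg oX cG Xx Xx).
have c2 : G y y @[y --> x] --> G x x.
  apply: (@cvg_comp _ _ _ (fun y => (y, y)) (fun z => G z.1 z.2) _ (nbhs (x, x)) _).
    exact: (@cvg_pair _ _ _ (nbhs x) (nbhs x) (nbhs x) _ _ _ id id cvg_id cvg_id).
  exact: (jointly_continuous_cvg oX cG Xx Xx).
have c3 : Num.sqrt (G y y - 2 * G y x + G x x) @[y --> x] --> (0 : R).
  exact: cvg_sqrt_polarization c2 c1.
apply: cvg_trans c3; apply: (@near_eq_cvg _ _ (nbhs x)).
have : nbhs x X by exact: open_nbhs_nbhs.
apply: (@filterS _ (nbhs x)) => y Xy; rewrite /hnorm dotBl !dotBr (dotC (F x) (F y)) !FG//.
by congr Num.sqrt; ring.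
Qed.

(** * The Stein feature map *)

Section stein.
Context {R : realType} {d : nat} {X : set 'rV[R]_d} {k : 'rV[R]_d -> 'rV[R]_d -> R}.
Variable H : rkhs X k.
Variable p0 : 'rV[R]_d -> R.
Hypothesis X_open : open X.
Hypothesis k_C11 : C11 X k.
Hypothesis p0_C1 : C1 X p0.
Hypothesis p0_gt0 : forall x, X x -> 0 < p0 x.
Implicit Types x y : 'rV[R]_d.
Local Notation e_ i := (delta_mx 0 i : 'rV[R]_d).
Local Notation E := (hilbert_pow d H).

(** The chain rule for one real variable, along the i-th coordinate line; the score becomes a
    quotient of continuous functions. *)
Lemma score_component x i : X x ->
  score p0 x 0 i = (p0 x)^-1 * grad p0 x 0 i.
Proof.
move=> Xx; rewrite !mxE.
have line (f : 'rV[R]_d -> R) : 'D_(e_ i) f x = 'D_1 (fun s : R => f (x + s *: e_ i)) 0.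
  rewrite /derive; set f1 := (X in lim (X @ _) = _); set f2 := (X in _ = lim (X @ _)).
  suff -> : f1 = f2 by [].
  apply/funext => h; rewrite /f1 /f2 /=.
  by rewrite [h *: 1]mulr1 addr0 scale0r addr0 [_ + x]addrC.
have dp : is_derive (0 : R) 1 (fun s : R => p0 (x + s *: e_ i)) ('D_(e_ i) p0 (x + 0 *: e_ i)).
  apply: is_derive_line; rewrite scale0r addr0.
  exact/diff_derivable/p0_C1.1.
have dl : is_derive (p0 (x + 0 *: e_ i)) 1 (@ln R) (p0 x)^-1.
  by rewrite scale0r addr0; apply: is_derive1_ln; exact: p0_gt0.
have [_ dE] := is_derive1_comp dl dp.
by rewrite line; apply: etrans dE _; rewrite scale0r addr0.
Qed.

Lemma score_cvg x i : X x -> score p0 y 0 i @[y --> x] --> score p0 x 0 i.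
Proof.
move=> Xx; rewrite score_component//.
have h1 : p0 y @[y --> x] --> p0 x by apply: differentiable_continuous; exact: p0_C1.1.
have h2 : grad p0 y 0 i @[y --> x] --> grad p0 x 0 i.
  apply: (@cvg_comp _ _ _ (grad p0) (fun M : 'rV[R]_d => M 0 i) _ (nbhs (grad p0 x)) _ _
    (@coord_continuous _ _ _ 0 i (grad p0 x))).
  exact: within_open_cvg p0_C1.2.
have h3 : (p0 y)^-1 * grad p0 y 0 i @[y --> x] --> (p0 x)^-1 * grad p0 x 0 i.
  by apply: cvgM h2; apply: cvgV h1; rewrite gt_eqF// p0_gt0.
apply: cvg_trans h3; apply: (@near_eq_cvg _ _ (nbhs x)).
have : nbhs x X by exact: open_nbhs_nbhs.
by apply: (@filterS _ (nbhs x)) => y Xy; rewrite score_component.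
Qed.

Lemma cvg_hnorm_pow (T : Type) (F : set_system T) (u : T -> E) (l : E) : Filter F ->
  (forall i, hnorm (u y i - l i) @[y --> F] --> (0 : R)) ->
  hnorm (u y - l) @[y --> F] --> (0 : R).
Proof.
move=> FF ul.
have h : \sum_(i < d) hnorm (u y i - l i) ^+ 2 @[y --> F] --> (0 : R).
  rewrite [X in _ --> X](_ : _ = \sum_(i < d) 0); last by rewrite big1.
  apply: cvg_big => [|i _]; first exact: add_continuous.
  rewrite -[X in _ --> X](mulr0 (0 : R)); under eq_fun do rewrite expr2.
  by apply: cvgM; exact: ul.
have := cvg_comp _ _ h (@sqrt_continuous R 0); rewrite sqrtr0.
rewrite (_ : (fun z => hnorm (u z - l)) =
    Num.sqrt \o fun z => \sum_(i < d) hnorm (u z i - l i) ^+ 2)//.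
apply/funext => z; rewrite /hnorm /=; congr Num.sqrt; apply: eq_bigr => i _.
by rewrite sqr_hnorm !ffunE.
Qed.

Lemma stein_feature_cvg x : X x ->
  hnorm (stein_feature H p0 y - stein_feature H p0 x : E) @[y --> x] --> (0 : R).
Proof.
move=> Xx; apply: (@cvg_hnorm_pow _ (nbhs x)) => i.
under eq_fun do rewrite !ffunE.
apply: (@cvg_hnormD _ _ _ (nbhs x)).
  apply: (@cvg_hnormZ _ _ _ (nbhs x)); first exact: score_cvg.
  have [k0 _ _ _] := k_C11.
  exact: (kernel_map_continuous X_open k0 (@dot_rkhs_elt _ _ _ _ H) Xx).
have [_ _ _ k12] := k_C11.
exact: (kernel_map_continuous X_open (k12 i i).2 (dot_rkhs_partial H X_open k_C11 i) Xx).
Qed.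

End stein.

(** * Strong measurability of maps continuous on an open subset of R^d *)

Section borel_strong_measurability.
Context {R : realType} {d : nat} {E : hilbertType R} {X : set 'rV[R]_d}.
Hypothesis X_open : open X.
Implicit Types x y : 'rV[R]_d.
Variable F : 'rV[R]_d -> E.
Hypothesis F_cvg : forall x, X x -> hnorm (F y - F x) @[y --> x] --> (0 : R).

Lemma open_measurable_borel (A : set 'rV[R]_d) : open A -> measurable (A : set (borel R d)).
Proof. by move=> oA; exact: sub_sigma_algebra. Qed.

Lemma rational_dense x (A : set 'rV[R]_d) : nbhs x A ->
  exists q : 'rV[rat]_d, A (map_mx ratr q).
Proof.
move=> /nbhs_ballP[r /= r0 rA].
have /choice[q qP] : forall i : 'I_d, exists q : rat, `|x 0 i - ratr q| < r.
  move=> i; have [q] := @rat_in_itvoo R (x 0 i - r) (x 0 i + r) ltac:(lra).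
  by rewrite in_itv/= => qr; exists q; rewrite ltr_norml; lra.
exists (\row_i q i); apply: rA; split=> // i j.
by rewrite !mxE ord1; exact: qP.
Qed.

(** Continuity is available on [X] only, while [P0] and the law of the sample live on the whole of
    [borel R d]. *)
Definition zero_extension x : E := if x \in X then F x else 0.

(** Inside [X] the superlevel sets of the distance are open by the triangle inequality; outside [X]
    the distance is constant. *)
Lemma measurable_hnorm_zero_extension (u : E) :
  measurable_fun setT (fun x : borel R d => hnorm (zero_extension x - u)).
Proof.
apply: (measurability _ (RGenOInfty.measurableE R)) => _ [_ [r ->] <-]; rewrite setTI.
rewrite (_ : _ @^-1` _ = (X `&` [set x | r < hnorm (F x - u)]) `|`
    (~` X `&` [set x | r < hnorm (0 - u)])); last first.
  apply/seteqP; split=> x /=; rewrite in_itv/= andbT /zero_extension.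
    by have [/set_mem|] := boolP (x \in X); [left|rewrite notin_setE; right].
  by move=> [[Xx rx]|[Xx rx]]; [rewrite (mem_set Xx)|rewrite (memNset Xx)].
apply: measurableU; last first.
  apply: measurableI; first exact: (@measurableC _ (borel R d) _ (open_measurable_borel X_open)).
  rewrite (_ : [set _ | _] = if r < hnorm (0 - u) then setT else set0); first by case: ifP.
  by case: ifP => h; apply/seteqP; split=> // x /=; rewrite h.
apply: open_measurable_borel; rewrite openE => x [Xx /= rx].
have e0 : 0 < hnorm (F x - u) - r by rewrite subr_gt0.
have h1 : \forall y \near x, hnorm (F y - F x) < hnorm (F x - u) - r.
  have /cvgrPdist_lt/(_ _ e0) := F_cvg Xx.
  by apply: filterS => y; rewrite sub0r normrN ger0_norm// hnorm_ge0.
have h2 : nbhs x X by exact: open_nbhs_nbhs.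
apply: (@filterS2 _ (nbhs x) _ _ _ _ _ h1 h2) => y yx Xy; split=> //=.
have := ler_hnormB (F x) (F y) u; rewrite (hnormBC (F x) (F y)); lra.
Qed.

Lemma smeas_zero_extension : smeas (zero_extension : borel R d -> E).
Proof.
(* Index 0 holds the value taken outside [X]; the later indices enumerate the values at rational
   points, with 0 for the numbers that encode no point. *)
pose v n : E := if n is m.+1 then
  oapp (fun q : 'rV[rat]_d => zero_extension (map_mx ratr q)) 0 (choice.unpickle m) else 0.
apply: (@smeas_dense_values _ _ _ _ v) => [u|x e e0].
  exact: measurable_hnorm_zero_extension.
have [/set_mem Xx|xX] := boolP (x \in X); last first.
  by exists 0%N; rewrite /zero_extension (negbTE xX) subrr hnorm0.
have h1 : \forall y \near x, hnorm (F y - F x) < e.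
  have /cvgrPdist_lt/(_ _ e0) := F_cvg Xx.
  by apply: filterS => y; rewrite sub0r normrN ger0_norm// hnorm_ge0.
have h2 : nbhs x X by exact: open_nbhs_nbhs.
have [q [qX qe]] := rational_dense (filterI h2 h1).
exists (choice.pickle q).+1; rewrite /v choice.pickleK /= /zero_extension !mem_set//.
by rewrite hnormBC.
Qed.

End borel_strong_measurability.

Unset Implicit Arguments.
Set Strict Implicit.
Set Printing Implicit Defensive.

Theorem proposition7 (R : realType) (d : nat) (X : set 'rV[R]_d)
    (p0 : 'rV[R]_d -> R) (P0 : probability (borel R d) R)
    (k : 'rV[R]_d -> 'rV[R]_d -> R) (Hk : rkhs X k)
    (disp : measure_display) (Omega : measurableType disp)
    (P : probability Omega R) (n : nat) (Xs : 'I_n -> Omega -> borel R d)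
    (X_open : open X)
    (p0_density : has_density X P0 p0)
    (p0_C1 : C1 X p0)
    (p0_gt0 : forall x, X x -> 0 < p0 x)
    (k_C11 : C11 X k)
    (k_pd : positive_definite X k)
    (Xs_in : forall i w, X (Xs i w))
    (Xs_iid : iid P Xs P0) :
  let K := stein_kernel Hk p0 in
  let EK := (\int[P0]_(x in X) (K x x)%:E)%E in
  let EK2 := (\int[P0]_(x in X) (K x x ^+ 2)%:E)%E in
  let trC := fine (trace (stein_covariance Hk p0 P0)) in
  (EK < +oo)%E ->
  is_bochner_integral P0 X (stein_feature Hk p0) 0 ->
  0 < trC ->
  (EK2 < +oo)%E ->
  Num.ceil (fine EK2 / trC ^+ 2) <= n%:Z ->
  let EKSD := ('E_P[fun w => ksd_V Hk p0 (fun i => Xs i w)])%E in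
  ((1 / 2 * Num.sqrt (trC / n%:R))%:E <= EKSD)%E /\
  (EKSD <= (Num.sqrt (trC / n%:R))%:E)%E.
Proof.
set E := hilbert_pow d Hk; set F : borel R d -> E := stein_feature Hk p0.
move=> K EK EK2 trC EK_fin F_mean0 trC_gt0 EK2_fin n_ge EKSD.
have mX : measurable (X : set (borel R d)) by exact: open_measurable_borel.
pose Z : borel R d -> E := zero_extension (X := X) F.
have mZ : smeas Z.
  by apply: smeas_zero_extension => // x Xx; exact: stein_feature_cvg.
have ZF x : X x -> Z x = F x by move=> Xx; rewrite /Z /zero_extension mem_set.
have Z0 x : ~ X x -> Z x = 0 by move=> Xx; rewrite /Z /zero_extension memNset.
pose q x := hdot E (Z x) (Z x).
(* Outside [X] the extension makes [q] equal to 0, and only its positive powers vanish there. *)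
have qE m : (0 < m)%N ->
    (\int[P0]_(x in X) (K x x ^+ m)%:E = \int[P0]_x (q x ^+ m)%:E)%E.
  move=> m0; rewrite integral_mkcond; apply: eq_integral => x _; rewrite /patch.
  have [/set_mem Xx|] := boolP (x \in X); first by rewrite /q ZF.
  by rewrite notin_setE => /Z0; rewrite /q => ->; rewrite dot0l expr0n gtn_eqF.
have q_ge0 x : 0 <= q x by exact: dot_ge0.
have iq m : (0 < m)%N -> (\int[P0]_(x in X) (K x x ^+ m)%:E < +oo)%E ->
    P0.-integrable setT (EFin \o (fun x => q x ^+ m)).
  move=> m0; rewrite qE// => fin; apply/integrableP; split.
    exact/measurable_EFinP/measurable_funX/smeas_dot.
  apply: le_lt_trans fin; rewrite le_eqVlt; apply/orP; left; apply/eqP.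
  by apply: eq_integral => x _; rewrite /= ger0_norm// exprn_ge0.
have iq1 : P0.-integrable setT (EFin \o q) := iq 1%N isT EK_fin.
have iq2 := iq 2%N isT EK2_fin.
have trCE : trC = \int[P0]_x q x.
  rewrite /trC (trace_covariance (Z := Z) mX mZ _ _ trC_gt0)//; last first.
    exact: integrableS iq1.
  rewrite Rintegral_mkcond; apply: eq_Rintegral => x _; rewrite /patch.
  case: ifPn => //; rewrite notin_setE => /Z0.
  by rewrite /q => ->; rewrite dot0l.
(* Stein's identity is a Bochner integral; the moment bounds take it in this scalar form. *)
have Z_mean0 v : \int[P0]_x hdot E v (Z x) = 0.
  have iZ := sqr_integrable_hnorm measurableT mZ iq1.
  have iZX : P0.-integrable X (EFin \o (fun x => hnorm (Z x))) by exact: integrableS iZ.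
  have Z_mean : is_bochner_integral P0 X Z 0.
    by apply: is_bochner_integral_ext F_mean0 => x Xx; rewrite ZF.
  rewrite -(dot0r v) -(bochner_integral_dot mX v mZ iZX Z_mean) [RHS]Rintegral_mkcond.
  apply: eq_Rintegral => x _; rewrite /patch.
  by case: ifPn => //; rewrite notin_setE => /Z0 ->; rewrite dot0r.
have EKSDE : EKSD = (\int[P]_w (hnorm (n%:R^-1 *: \sum_(i < n) Z (Xs i w)))%:E)%E.
  rewrite /EKSD unlock; apply: eq_integral => w _; rewrite /ksd_V.
  by congr (hnorm (_ *: _))%:E; apply: eq_bigr => i _; rewrite ZF.
(* For n = 0 the inverse of n is 0 by convention, and both bounds and the mean are 0. *)
have [n0|n_gt0] := posnP n.
  have nV : n%:R^-1 = 0 :> R by rewrite n0 invr0.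
  rewrite EKSDE nV mulr0 sqrtr0 mulr0 (eq_integral (cst 0%E)); last first.
    by move=> w _; rewrite scale0r hnorm0.
  by rewrite integral_cst// mul0e.
rewrite EKSDE trCE; apply: iid_mean_hnorm_bounds => //.
  by rewrite -trCE.
(* An integer is above the ceiling exactly when it is above the number itself; clearing the
   denominator leaves kappa <= n tau^2. *)
move: n_ge; rewrite ceil_le_int ler_pdivrMr ?exprn_gt0// trCE.
by rewrite /EK2 (qE 2%N)// -pmulrn.
Qed.
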